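(* Let $G$ be a finite soluble group and let $a\leq b$ be non-negative integers with $a+b\geq d(G)$. Then $$\operatorname{diam}(\Gamma^*_{a,b}(G))\leq 4.$$ Moreover: (1) Assume $a=b$. If either $G$ has the property that $|\operatorname{End}_G(V)|>2$ for every non-trivial irreducible $G$-module $V$ which is $G$-isomorphic to a complemented chief factor of $G$, or $a\neq 1$, then $\operatorname{diam}(\Gamma^*_{a,a}(G))\leq 2$. Otherwise $\operatorname{diam}(\Gamma^*_{a,a}(G))\leq 3$. (2) Assume $a<b$. If either $G$ has the property that $|\operatorname{End}_G(V)|>2$ for every non-trivial irreducible $G$-module $V$ which is $G$-isomorphic to a complemented chief factor of $G$, or $a\neq 1$, then $\operatorname{diam}(\Gamma^*_{a,b}(G))\leq 3$.
   Context: For a finite group $G$, $d(G)$ is the smallest cardinality of a generating set of $G$. For non-negative integers $a\leq b$, $\Gamma_{a,b}(G)$ is the undirected graph, possibly with loops, whose vertices are the elements of $G^a\cup G^b$ (a disjoint union if $a\neq b$, just $G^a$ if $a=b$; $G^0$ consists of the single empty tuple), in which $(x_1,\dots,x_a)\in G^a$ and $(y_1,\dots,y_b)\in G^b$ are adjacent if and only if $\langle x_1,\dots,x_a,y_1,\dots,y_b\rangle=G$. If $a\neq b$ there are no other edges; if $a=b$ there is a loop at $x\in G^a$ exactly when the entries of $x$ generate $G$. A vertex is isolated if it is adjacent to no vertex (itself included). $\Gamma^*_{a,b}(G)$ is obtained from $\Gamma_{a,b}(G)$ by deleting the isolated vertices. The diameter of a graph is the supremum of the distances between its vertices. A chief factor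 $X/Y$ of $G$ is complemented if $X/Y$ has a complement in $G/Y$; abelian chief factors are regarded as $G$-modules via conjugation. A non-trivial irreducible $G$-module is one on which $G$ acts non-trivially. *)

(* Defs.v *)
From mathcomp Require Import all_boot all_fingroup all_solvable.

Set Implicit Arguments.
Unset Strict Implicit.
Unset Printing Implicit Defensive.

Local Open Scope group_scope.

(* A finite undirected graph, possibly with loops. *)
Record graph := Graph {
  vertex : finType;
  adj : rel vertex;
  adj_sym : symmetric adj
}.

Section Distance.

Variable X : graph.
Implicit Types x y : vertex X.

Definition walk x y (n : nat) : bool :=
  [exists p : n.-tuple (vertex X), path (@adj X) x p && (last x p == y)].

Lemma walkP x y n :
  reflect (exists p : seq (vertex X),
             [/\ path (@adj X) x p, last x p = y & size p = n])
          (walk x y n).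
Proof.
apply: (iffP existsP) => [[p /andP[xp /eqP lp]] | [p [xp lp sp]]].
  by exists p; rewrite size_tuple.
have sp' : size p == n by apply/eqP.
by exists (Tuple sp'); rewrite /= xp lp eqxx.
Qed.

Lemma connect_walk x y : connect (@adj X) x y -> exists n, walk x y n.
Proof. by move=> /connectP[p xp ->]; exists (size p); apply/walkP; exists p. Qed.

(* Values in [option nat]: [None] stands for infinity. *)
Definition dist x y : option nat :=
  match @idP (connect (@adj X) x y) with
  | ReflectT xy => Some (ex_minn (connect_walk xy))
  | ReflectF _ => None
  end.

Definition diam : option nat :=
  if [forall x, forall y, dist x y != None]
  then Some (\max_x \max_y odflt 0 (dist x y))
  else None.

End Distance.

Definition le_ext (d : option nat) (n : nat) : bool :=
  if d is Some m then m <= n else false.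

Lemma dist_leP (X : graph) (x y : vertex X) n :
  reflect (exists p : seq (vertex X),
             [/\ path (@adj X) x p, last x p = y & size p <= n])
          (le_ext (dist x y) n).
Proof.
rewrite /dist; case: {-}_ / idP => [xy | nxy].
  case: ex_minnP => m walk_m min_m; apply: (iffP idP) => [le_mn | [p [xp lp]]].
    by case/walkP: walk_m => p [xp lp sp]; exists p; rewrite sp.
  by apply: leq_trans; apply: min_m; apply/walkP; exists p.
by constructor=> -[p [xp lp _]]; apply: nxy; apply/connectP; exists p.
Qed.

Lemma diam_leP (X : graph) n :
  reflect (forall x y : vertex X, le_ext (dist x y) n) (le_ext (diam X) n).
Proof.
rewrite /diam; case: ifPn => [/forallP fin | infin].
  apply: (iffP idP) => [/bigmax_leqP le_n x y | le_n].
    move/(_ x isT)/bigmax_leqP/(_ y isT): le_n.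
    by move/forallP/(_ y): (fin x); case: (dist x y).
  apply/bigmax_leqP=> x _; apply/bigmax_leqP=> y _.
  by move: (le_n x y); case: (dist x y).
constructor=> le_n; case/negP: infin; apply/forallP=> x; apply/forallP=> y.
by move: (le_n x y); case: (dist x y).
Qed.

Definition isolated (X : graph) (x : vertex X) : bool :=
  [forall y, ~~ adj x y].

Definition del_isolated (X : graph) : graph :=
  @Graph {x : vertex X | ~~ isolated x}
         (fun x y => adj (val x) (val y))
         (fun x y => adj_sym (val x) (val y)).

Section GeneratingGraph.

Variables (gT : finGroupType) (G : {group gT}) (a b : nat).

(* For [a <= b], a vertex is a sequence of elements of G whose length is a or b.
   Since sequences of different lengths differ, this is the disjoint union of
   G^a and G^b when a != b, and G^a when a = b. *)
Definition gen_vertex : finType :=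
  {s : b.-bseq gT | ((size s == a) || (size s == b)) && all [in G] s}.

Definition gen_adj (s t : gen_vertex) : bool :=
  (((size (val s) == a) && (size (val t) == b))
   || ((size (val s) == b) && (size (val t) == a)))
  && (<<[set x | x \in (val s : seq gT) ++ (val t : seq gT)]>> == G).

Lemma gen_adj_sym : symmetric gen_adj.
Proof.
move=> s t; rewrite /gen_adj; congr (_ && _).
  by rewrite orbC andbC [(size (val s) == a) && _]andbC.
by congr (<<_>> == _); apply/setP=> x; rewrite !inE !mem_cat orbC.
Qed.

Definition gen_graph : graph := Graph gen_adj_sym.

Definition gen_graph_star : graph := del_isolated gen_graph.

End GeneratingGraph.

(* A finite G-module is an abelian group V with an action of G on V by
   automorphisms; following the library, the action is on the right. *)
Section Modules.

Variables (gT vT : finGroupType) (G : {group gT}) (V : {group vT}).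
Variable to : groupAction G V.

Definition irreducible_module : bool := abelian V && acts_irreducibly G V to.

Definition nontrivial_module : bool := ~~ (G \subset 'C(V | to)).

(* Endomorphisms of V are represented by functions with value 1 outside V. *)
Definition module_End : {set {ffun vT -> vT}} :=
  [set f : {ffun vT -> vT} | [&& f \in pffun_on 1 V V, morphic V f
    & [forall v in V, forall g in G, f (to v g) == to (f v) g]]].

Definition module_isog_factor (X Y : {group gT}) : Prop :=
  exists2 f : {morphism V >-> coset_of Y}, isom V (X / Y) f
    & {in V & G, forall v g, f (to v g) = f v ^ coset Y g}.

End Modules.

Definition complemented_chief_factor (gT : finGroupType)
    (G X Y : {group gT}) : bool :=
  chief_factor G Y X && [splits G / Y, over X / Y].

Definition End_gt2 (gT : finGroupType) (G : {group gT}) : Prop :=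
  forall (vT : finGroupType) (V : {group vT}) (to : groupAction G V),
    irreducible_module to -> nontrivial_module to ->
    (exists X Y : {group gT},
       complemented_chief_factor G X Y /\ module_isog_factor to X Y) ->
    2 < #|module_End to|.

(* Main.v *)
Require Import Defs.
From mathcomp Require Import all_boot all_fingroup all_solvable zify.

(** Two tuples X1, X2 of the same length are at distance at most 2 as soon as
    some tuple Y on the other side of the graph generates G together with each
    of them.  The bounds 2, 3 and 4 follow formally once such a Y is known to
    exist whenever X1 and X2 have neighbours of length b and either b > 1, or
    b = 1 and the modules in question have more than two endomorphisms
    ([common_neighbour]).  For a = b = 1 without assumption on the modules, Y is
    replaced by a path x, y1, y2, x' ([walk_exists]).

    Both existence statements are lifted along normal subgroups of G.  Arguing
    in a quotient, one may assume a solution modulo every minimal normal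
    subgroup N and must find one in G itself.  As N is abelian and minimal,
    N <X, Y> = G means that <X, Y> is G or a complement of N.  For fixed X and
    Y, the tuples n over N for which <X, Y n> is not G correspond one to one to
    the complements of N containing X, so their number does not depend on Y;
    this is Gaschuetz' lemma ([gaschutz]).  Complements of N form a torsor under
    derivations ([cofactor_quotient]), so these n form a coset of a subgroup of
    the power of N.  If no n is good for X1 and X2 at once, it follows that each
    of X1 and X2 lies in a complement of N, that no complement of N contains
    both ([common_lift]), and that N has at least |N|^b complements.

    When G is nilpotent, this forces G to be abelian and X1, X2 to be trivial.
    Otherwise there is an abelian normal subgroup E <> 1 and a subgroup S such
    that every supplement M of E is (E :&: M) S^e for some e in E
    ([nonnilpotent_split]).  Then X1 and X2 lie in complements S1 and S1^e of E.
    A normal subgroup of G complementing N in E cannot contain e, since together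
    with S1 it would generate a complement of N containing X1 and X2.  Hence the
    conjugates of e generate E, a normal complement of N in E is determined by
    the projection of e to N, which is not 1, and N has at most (|N| - 1)|N|
    complements, fewer than |N|^2.  This settles b > 1.  For b = 1 and N in E,
    the cosets of bad n are stable under the G-endomorphisms of N, hence contain
    at most a third of N, and two of them cannot cover N.

    For paths x, y1, y2, x', assume that none exists, and let N lie in E.  The n
    with <x, y1 n> = G then form a subgroup of index 2 of N, and counting
    complements of N shows that those containing x contain the complement S1 of
    E through x.  Write y1 = k1 u1 with k1 in S1 and u1 in E, and y2 = k2 u2
    likewise for x'.  Then f |-> f u1 is a bijection from the G-homomorphisms
    E -> N onto N, and f u1 = [k1, v] implies f u2 = [k2, v]
    ([broken_transfer]).  Replacing y1 by y1 n changes the first equation but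
    not the second, which is absurd ([no_walkless_group]). *)

Set Implicit Arguments.
Unset Strict Implicit.
Unset Printing Implicit Defensive.

Local Open Scope group_scope.

(** * Complements of a minimal normal subgroup *)

Lemma mulg_lift (gT : finGroupType) (y z c d : gT) :
  (y * c) * (z * d) = y * z * (c ^ z * d).
Proof. by rewrite conjgE !mulgA mulgK. Qed.

Section Complements.

Variables (gT : finGroupType) (G N : {group gT}).
Hypotheses (minN : minnormal N G) (sNG : N \subset G) (abelN : abelian N).
Implicit Types (H K L M : {group gT}) (X Z : {set gT}).

Local Notation compl := [complements to N in G].

Lemma minnormal_norm : G \subset 'N(N).
Proof. by case/mingroupP: minN => /andP[]. Qed.

Lemma minnormal_cases K :
  K \subset N -> G \subset 'N(K) -> K :=: 1 \/ K :=: N.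
Proof.
move=> sKN nKG; have [->|ntK] := eqVneq K 1%G; first by left.
by right; case/mingroupP: minN => _; apply=> //; rewrite ntK.
Qed.

Lemma compl_sub M : M \in compl -> M \subset G.
Proof. by case/complP=> _ <-; apply: mulG_subr. Qed.

Lemma compl_TI M x : M \in compl -> x \in N -> x \in M -> x = 1.
Proof.
by case/complP=> tiNM _ Nx Mx; apply/set1P; rewrite -[[set 1]]tiNM inE Nx.
Qed.

Lemma memJN x y : x \in N -> y \in G -> x ^ y \in N.
Proof. by move=> Nx Gy; rewrite memJ_norm ?(subsetP minnormal_norm). Qed.

(** N :&: H is normalised by H and, N being abelian, by N; so it is normal in
    N * H = G and minimality leaves only 1 and N. *)
Lemma supplement_cases H :
  H \subset G -> N * H = G -> H :=: G \/ H \in compl.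
Proof.
move=> sHG defG; have [] := @minnormal_cases (N :&: H) _ _.
- exact: subsetIl.
- rewrite -{1}defG mulG_subG /=; apply/andP; split.
    exact: subset_trans (sub_abelian_cent abelN (subsetIl _ _)) (cent_sub _).
  by rewrite normsI ?normG // (subset_trans sHG minnormal_norm).
- by move=> tiNH; right; apply/complP.
by move=> /setIidPl sNH; left; rewrite -defG mulSGid.
Qed.

(** The element n of N with y * n in M.  The value is locked because otherwise
    rewriting with associativity looks inside it. *)
Definition cofactor M y := locked (y^-1 * remgr N M y).

Lemma cofactorE M y : cofactor M y = y^-1 * remgr N M y.
Proof. by rewrite /cofactor -lock. Qed.

Lemma mul_cofactor M y : M \in compl -> y \in G -> y * cofactor M y \in M.
Proof.
by case/complP=> _ defG; rewrite -defG => NMy; rewrite cofactorE mulKVg mem_remgr.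
Qed.

Lemma mem_cofactor M y : M \in compl -> y \in G -> cofactor M y \in N.
Proof.
move=> cM Gy; have:= cM; case/complP=> tiNM defG.
have NMy: y \in N * M by rewrite defG.
have ->: cofactor M y = (divgr N M y)^-1 ^ remgr N M y.
  by rewrite cofactorE {1}(divgr_eq N M y) invMg -mulgA.
apply: memJN; first by rewrite groupV mem_divgr.
by apply: (subsetP (compl_sub cM)); rewrite mem_remgr.
Qed.

Lemma cofactor_uniq M y n n' : M \in compl ->
  n \in N -> n' \in N -> y * n \in M -> y * n' \in M -> n = n'.
Proof.
move=> cM Nn Nn' Myn Myn'; apply/eqP; rewrite eq_mulVg1; apply/eqP.
apply: (compl_TI cM); first by rewrite groupM ?groupV.
by rewrite -(groupMl _ Myn) mulgA mulgK.
Qed.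

Lemma cofactorM M M0 : M \in compl -> M0 \subset G ->
  {in M0 &, forall y z, cofactor M (y * z) = cofactor M y ^ z * cofactor M z}.
Proof.
move=> cM sMG y z /(subsetP sMG) Gy /(subsetP sMG) Gz.
have Gyz := groupM Gy Gz.
apply: (cofactor_uniq cM (mem_cofactor cM Gyz) _ (mul_cofactor cM Gyz)).
  by rewrite groupM ?memJN ?mem_cofactor.
by rewrite -mulg_lift groupM ?mul_cofactor.
Qed.

(** The graph of a derivation of a complement: y |-> y * d y is multiplicative
    on M0 precisely because of the cocycle rule. *)
Lemma derivation_compl M0 (d : gT -> gT) : M0 \in compl ->
    {in M0, forall y, d y \in N} ->
    {in M0 &, forall y z, d (y * z) = d y ^ z * d z} ->
  exists2 M, M \in compl & {in M0, forall y, y * d y \in M}.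
Proof.
move=> cM0 Nd dM; have sM0G := compl_sub cM0.
have d1: d 1 = 1.
  have:= dM 1 1 (group1 _) (group1 _); rewrite mulg1 conjg1 => /eqP.
  by rewrite eq_mulVg1 mulKg => /eqP.
have gM: group_set [set y * d y | y in M0].
  apply/group_setP; split.
    by apply/imsetP; exists 1; rewrite ?group1 // d1 mulg1.
  move=> _ _ /imsetP[y My ->] /imsetP[z Mz ->].
  by apply/imsetP; exists (y * z); rewrite ?groupM // dM // mulg_lift.
exists (Group gM); last by move=> y My; apply: imset_f.
apply/complP; split.
  apply/trivgP/subsetP=> _ /setIP[/[swap] /imsetP[y My ->]] Nyd.
  have Ny: y \in N by rewrite -(groupMr _ (Nd y My)).
  by rewrite (compl_TI cM0 Ny My) d1 mulg1 inE.
have /complP[_ defG] := cM0.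
apply/eqP; rewrite eqEsubset mul_subG //=; last first.
  apply/subsetP=> _ /imsetP[y My ->].
  by rewrite groupM ?(subsetP sM0G y) // (subsetP sNG) ?Nd.
apply/subsetP=> x; rewrite -{1}defG => /mulsgP[n y Nn My ->].
apply/mulsgP; exists (n * (d y)^-1 ^ y^-1) (y * d y).
- by rewrite groupM // memJN ?groupV ?Nd ?(subsetP sM0G).
- exact: imset_f.
by rewrite conjgE invgK !mulgA !mulgKV.
Qed.

(** Complements of N form a torsor under the derivations M0 -> N, so they can be
    divided once a base point M0 is chosen; on elements of M0 the division
    divides the cofactors. *)
Lemma cofactor_quotient M0 M M' : M0 \in compl -> M \in compl -> M' \in compl ->
  exists2 M'', M'' \in compl & forall y n n', y \in M0 -> n \in N -> n' \in N ->
    y * n \in M -> y * n' \in M' -> y * (n * n'^-1) \in M''.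
Proof.
move=> cM0 cM cM'; have sM0G := compl_sub cM0.
have cNN := centsP abelN.
have [] := @derivation_compl M0 (fun y => cofactor M y * (cofactor M' y)^-1) cM0.
- move=> y /(subsetP sM0G) Gy.
  by rewrite groupM ?groupV // mem_cofactor.
- have quotM a b c d : a \in N -> b \in N -> c \in N -> d \in N ->
      a * b * (c * d)^-1 = a * c^-1 * (b * d^-1).
    move=> Na Nb Nc Nd; rewrite invMg -!mulgA; congr (_ * _).
    by rewrite [RHS]cNN ?groupM ?groupV // mulgA.
  move=> y z My Mz /=; rewrite !(cofactorM _ sM0G) // conjMg conjVg.
  have Gy := subsetP sM0G y My; have Gz := subsetP sM0G z Mz.
  by apply: quotM; rewrite ?memJN ?mem_cofactor.
move=> M'' cM'' M''d; exists M'' => // y n n' My Nn Nn' Myn Myn'.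
have Gy := subsetP sM0G y My.
have ->: n = cofactor M y.
  by apply: (cofactor_uniq cM) Myn _; rewrite ?mem_cofactor ?mul_cofactor.
have ->: n' = cofactor M' y.
  by apply: (cofactor_uniq cM') Myn' _; rewrite ?mem_cofactor ?mul_cofactor.
exact: M''d.
Qed.

(** Composing a derivation with a G-endomorphism of N gives a derivation, so
    G-endomorphisms act on complements as soon as a base point is chosen. *)
Lemma cofactor_endo M0 M (f : gT -> gT) : M0 \in compl -> M \in compl ->
    {in N, forall n, f n \in N} -> {in N &, {morph f : n n' / n * n'}} ->
    {in N & G, forall n g, f (n ^ g) = f n ^ g} ->
  exists2 M', M' \in compl &
    forall y n, y \in M0 -> n \in N -> y * n \in M -> y * f n \in M'.
Proof.
move=> cM0 cM Nf fM fJ; have sM0G := compl_sub cM0.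
have [] := @derivation_compl M0 (fun y => f (cofactor M y)) cM0.
- by move=> y /(subsetP sM0G) Gy; rewrite Nf ?mem_cofactor.
- move=> y z My Mz /=; have Gy := subsetP sM0G y My.
  have Gz := subsetP sM0G z Mz.
  by rewrite (cofactorM _ sM0G) // fM ?fJ ?memJN ?mem_cofactor.
move=> M' cM' M'd; exists M' => // y n My Nn Myn.
have Gy := subsetP sM0G y My.
have ->: n = cofactor M y.
  by apply: (cofactor_uniq cM) Myn _; rewrite ?mem_cofactor ?mul_cofactor.
exact: M'd.
Qed.

Lemma compl_conj M g : M \in compl -> g \in G -> (M :^ g)%G \in compl.
Proof.
case/complP=> tiNM defG Gg; apply/complP; rewrite /= -(normsP minnormal_norm g Gg).
by rewrite -conjIg tiNM conjs1g -conjsMg defG conjGid.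
Qed.

Lemma gen_supplement Z : Z \subset G -> N * <<Z>> = G ->
  <<Z>> = G \/ <<Z>>%G \in compl.
Proof. by move=> sZG; apply: supplement_cases; rewrite gen_subG. Qed.

Lemma gen_compl Z M : M \in compl -> Z \subset M -> N * <<Z>> = G -> <<Z>> = M.
Proof.
move=> cM sZM genZ; have sHM: <<Z>> \subset M by rewrite gen_subG.
have [eqG | /complP[tiH defH]] := gen_supplement (subset_trans sZM (compl_sub cM)) genZ.
  by apply/eqP; rewrite eqEsubset sHM eqG compl_sub.
apply/eqP; rewrite eqEcard sHM /=; have /complP[tiM defM] := cM.
by rewrite -(leq_pmul2l (cardG_gt0 N)) -!TI_cardMg // defM defH.
Qed.

Section Tuples.

Variable b : nat.
Implicit Types Y n : 'I_b -> gT.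

Definition entries Y := [set Y i | i : 'I_b].

Lemma entries_subP Y Z : reflect (forall i, Y i \in Z) (entries Y \subset Z).
Proof.
apply: (iffP subsetP) => [sYZ i | ZY _ /imsetP[i _ ->] //].
by apply: sYZ; apply: imset_f.
Qed.

(** A complement M rules out exactly one of the |N|^b corrections n, namely the
    tuple of cofactors of the entries of Y. *)
Lemma avoid_compl (cM : {set {group gT}}) Y : entries Y \subset G ->
    {subset cM <= compl} -> #|cM| < #|N| ^ b ->
  exists2 n : 'I_b -> gT, forall i, n i \in N &
    forall M, M \in cM -> ~~ (entries (fun i => Y i * n i) \subset M).
Proof.
move=> /entries_subP GY scM ltMN.
pose f M := [ffun i : 'I_b => cofactor M (Y i)].
have [n /andP[/ffun_onP Nn]] : exists n : {ffun 'I_b -> gT}, (n \in ffun_on (mem N)) && (n \notin f @: cM).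
  apply/existsP; apply: contraLR ltMN; rewrite negb_exists => /forallP sNf.
  have <-: #|(ffun_on (mem N) : {pred {ffun 'I_b -> gT}})| = (#|N| ^ b)%N.
    by rewrite card_ffun_on card_ord.
  rewrite -leqNgt; apply: leq_trans (leq_imset_card f _); apply/subset_leq_card/subsetP=> n Nn.
  by have:= sNf n; rewrite negb_and negbK Nn.
move=> fn; exists n => // M cMM; apply: contra fn => /entries_subP Mn.
apply/imsetP; exists M => //; apply/ffunP=> i; rewrite ffunE.
have cM1 := scM M cMM.
apply: (cofactor_uniq cM1 _ _ (Mn i)); rewrite ?mem_cofactor ?mul_cofactor //.
Qed.

Definition compl_over X := [set M in compl | X \subset M].

Lemma gen_mulN X Y n : X \subset G -> entries Y \subset G ->
    (forall i, n i \in N) -> N * <<X :|: entries Y>> = G ->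
  N * <<X :|: entries (fun i => Y i * n i)>> = G.
Proof.
move=> sXG /entries_subP GY Nn defG; set H := <<_>>.
have sHG: H \subset G.
  rewrite gen_subG subUset sXG; apply/entries_subP=> i.
  by rewrite groupM // (subsetP sNG) ?Nn.
have nNH := subset_trans sHG minnormal_norm.
apply/eqP; rewrite eqEsubset mul_subG //= -norm_joinEr //.
rewrite -{1}defG mul_subG ?joing_subl // gen_subG subUset.
apply/andP; split.
  apply: subset_trans (joing_subr _ _); apply: subset_trans (subset_gen _).
  exact: subsetUl.
apply/entries_subP=> i; rewrite -[Y i](mulgK (n i)) groupM //.
  apply: (subsetP (joing_subr _ _)); rewrite mem_gen // inE orbC.
  by apply/orP; left; apply/imsetP; exists i.
by rewrite groupV (subsetP (joing_subl _ _)).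
Qed.

(** Each complement M containing X yields the correction that moves Y into M.
    Different complements yield different ones, because M is recovered as the
    group generated by X and the corrected Y; the trivial correction never
    arises, since X and Y generate G. *)
Lemma card_compl_over X Y : X \subset G -> entries Y \subset G ->
  <<X :|: entries Y>> = G -> #|compl_over X| < #|N| ^ b.
Proof.
move=> sXG sYG genY; have /entries_subP GY := sYG.
pose f M := [ffun i : 'I_b => cofactor M (Y i)].
have fN M i : M \in compl_over X -> f M i \in N.
  by rewrite inE ffunE => /andP[cM _]; rewrite mem_cofactor.
have fM M : M \in compl_over X -> X :|: entries (fun i => Y i * f M i) \subset M.
  rewrite inE => /andP[cM sXM]; rewrite subUset sXM; apply/entries_subP=> i.
  by rewrite ffunE mul_cofactor.
have injf: {in compl_over X &, injective f}.
  have gen_eq M : M \in compl_over X ->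
     <<X :|: entries (fun i => Y i * f M i)>> = M.
    move=> XM; have:= XM; rewrite inE => /andP[cM _].
    apply: gen_compl cM (fM M XM) _.
    by apply: gen_mulN => // [i|]; [apply: fN | rewrite genY mulSGid].
  move=> M M' XM XM' eq_f; apply: val_inj => /=.
  by rewrite -(gen_eq M XM) -(gen_eq M' XM') eq_f.
have cardNb: #|(ffun_on (mem N) : {pred {ffun 'I_b -> gT}})| = (#|N| ^ b)%N.
  by rewrite card_ffun_on card_ord.
rewrite -(card_in_imset injf) -cardNb.
apply: proper_card; apply/properP; split.
  by apply/subsetP=> _ /imsetP[M XM ->]; apply/ffun_onP=> i; apply: fN.
exists [ffun=> 1]; first by apply/ffun_onP=> i; rewrite ffunE group1.
apply/imsetP=> -[M XM eq1]; have:= XM; rewrite inE => /andP[cM _].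
have sGM: G \subset M.
  rewrite -genY gen_subG; apply: subset_trans (fM M XM).
  rewrite -eq1; apply: setUS; apply/entries_subP=> i.
  by apply/imsetP; exists i; rewrite // ffunE mulg1.
have /mingroupP[/andP[/negP ntN _] _] := minN; apply: ntN.
have /complP[tiM _] := cM.
by rewrite -tiM eq_sym; apply/eqP/setIidPl; apply: subset_trans sGM.
Qed.

(** Gaschuetz' lemma: the number of bad corrections of Y is at most the number
    of complements over X, and the latter, unlike Y, only depends on X. *)
Lemma gaschutz X Y Y0 : X \subset G -> entries Y0 \subset G ->
    <<X :|: entries Y0>> = G ->
    entries Y \subset G -> N * <<X :|: entries Y>> = G ->
  exists2 n : 'I_b -> gT, forall i, n i \in N &
    <<X :|: entries (fun i => Y i * n i)>> = G.
Proof.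
move=> sXG sY0G genY0 sYG genY; have /entries_subP GY := sYG.
have scX: {subset compl_over X <= compl} by move=> M; rewrite inE => /andP[].
have [n Nn avoid] := avoid_compl sYG scX (card_compl_over sXG sY0G genY0).
exists n => //.
set Z := X :|: _; have sZG: Z \subset G.
  rewrite subUset sXG; apply/entries_subP=> i.
  exact: groupM (GY i) (subsetP sNG _ (Nn i)).
have [//|cH] := gen_supplement sZG (gen_mulN sXG sYG Nn genY).
have XH: <<Z>>%G \in compl_over X.
  by rewrite inE cH (subset_trans _ (subset_gen _)) ?subsetUl.
by case/negP: (avoid _ XH); rewrite (subset_trans _ (subset_gen _)) ?subsetUr.
Qed.

End Tuples.

End Complements.

(** * Groups all of whose minimal normal subgroups are complemented *)

(** Q acts trivially on A / [A, Q], and by coprimality fixed points of this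
    quotient lift to fixed points in A. *)
Lemma coprime_commg_cent (gT : finGroupType) (Q A : {group gT}) :
    Q \subset 'N(A) -> coprime #|A| #|Q| -> solvable A ->
  [~: A, Q] * 'C_A(Q) = A.
Proof.
move=> nAQ coAQ solA; have sRA: [~: A, Q] \subset A by rewrite commg_subl.
apply/eqP; rewrite eqEsubset mul_subG ?subsetIl //=.
rewrite -quotientSK ?commg_norml //.
rewrite (strongest_coprime_quotient_cent (G := A)) ?commg_normr //=.
- rewrite subsetI subxx quotient_cents2r //.
- by rewrite setIid.
- by rewrite setIid (coprimeSg sRA).
by rewrite setIid (solvableS sRA).
Qed.

(** Supplements M of E are known up to E-conjugacy from E :&: M; for M with
    E :&: M = 1 this says that the complements of E are conjugate to S. *)
Definition supplements_split (gT : finGroupType) (G E S : {set gT}) :=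
  forall M : {group gT}, M \subset G -> E * M = G ->
    exists2 e, e \in E & (E :&: M) * S :^ e = M.

Lemma supplements_split_compl (gT : finGroupType) (G E S S1 : {group gT}) :
    supplements_split G E S -> S1 \subset G -> E * S1 = G -> E :&: S1 = 1 ->
  supplements_split G E S1.
Proof.
move=> supE sS1G defG1 tiES1 M sMG defEM.
have [e1 Ee1] := supE S1 sS1G defG1; rewrite tiES1 mul1g => defS1.
have [e Ee defM] := supE M sMG defEM.
exists (e1^-1 * e); first by rewrite groupM ?groupV.
by rewrite -defS1 conjsgM conjsgK.
Qed.

Section AllComplemented.

Variables (gT : finGroupType) (G : {group gT}).
Hypothesis solG : solvable G.
Hypothesis complG : forall N : {group gT}, minnormal N G -> N \subset G ->
  exists M, M \in [complements to N in G].
Implicit Types (A D E K M N P : {group gT}).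

(** If A were not abelian, its derived subgroup would meet the centre of A in a
    nontrivial normal subgroup of G, hence contain a minimal normal subgroup N of
    G central in A.  A complement of N in G cuts A into N times a subgroup with
    abelian quotient, so it contains the derived subgroup and hence N. *)
Lemma nilpotent_normal_abelian A : A <| G -> nilpotent A -> abelian A.
Proof.
move=> nsAG nilA; rewrite (sameP derG1P eqP); apply: contraT => ntA'.
have nsA'A: A^`(1) <| A := der_normal 1 A.
have ntZ := meet_center_nil nilA nsA'A ntA'.
have [|N minN sNZ] := minnormal_exists (G := G) ntZ.
  by rewrite normsI // !gFnorm_trans ?normal_norm.
have [sNA' sNZA] := subsetIP sNZ; have [sNA cAN] := subsetIP sNZA.
have [sAG nAG] := andP nsAG.
have [M /complP[tiNM defG]] := complG minN (subset_trans sNA sAG).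
have defA: N * (M :&: A) = A by rewrite group_modl // defG (setIidPr sAG).
have nMA: A \subset 'N(M :&: A).
  rewrite -{1}defA mulG_subG normG andbT cents_norm // (subset_trans cAN) //.
  by rewrite centS ?subsetIr.
have abq: abelian (A / (M :&: A)).
  have <-: (N * (M :&: A)) / (M :&: A) = A / (M :&: A) by rewrite defA.
  rewrite quotientMidr quotient_abelian //.
  by rewrite /abelian (subset_trans cAN) ?centS.
have sA'M := der1_min nMA abq.
have /mingroupP[/andP[/negP ntN _] _] := minN; case: ntN.
rewrite -subG1 -tiNM subsetI subxx /=.
by rewrite (subset_trans sNA') // (subset_trans sA'M) ?subsetIl.
Qed.

(** Take D minimal among the normal subgroups of G with P D = E.  If D met P, it
    would contain a minimal normal subgroup N <= P of G, and intersecting D with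
    a complement of N would give a smaller choice; the intersection is normal
    because E is abelian. *)
Lemma normal_abelian_split E P : E <| G -> abelian E -> P <| G -> P \subset E ->
  exists D, [/\ D <| G, P * D = E & P :&: D = 1].
Proof.
move=> nsEG abE nsPG sPE.
pose gD (D : {group gT}) := (G \subset 'N(D)) && (P * D == E).
have [|D] := @ex_mingroup _ gD.
  by exists E; rewrite /gD normal_norm //= mulSGid.
case/mingroupP=> /andP[nDG /eqP defE] minD.
have sDE: D \subset E by rewrite -defE mulG_subr.
have sDG := subset_trans sDE (normal_sub nsEG).
exists D; split=> //; first by apply/andP.
apply/eqP; apply: contraT => ntPD.
have [|N minN /subsetIP[sNP sND]] := minnormal_exists (G := G) ntPD.
  by rewrite normsI // normal_norm.
have [M /complP[tiNM defG]] := complG minN (subset_trans sND sDG).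
have defD: N * (M :&: D) = D by rewrite group_modl // defG (setIidPr sDG).
have sMDE: M :&: D \subset E by rewrite subIset // sDE orbT.
have nMD: G \subset 'N(M :&: D).
  rewrite -{1}defG mulG_subG; apply/andP; split; last first.
    rewrite normsI ?normG // (subset_trans _ nDG) // -defG mulG_subr //.
  rewrite cents_norm // centsC (subset_trans sMDE) //.
  by apply: subset_trans abE (centS _); apply: subset_trans sNP sPE.
have eqD: M :&: D = D.
  apply: (minD (M :&: D)%G); last exact: subsetIr.
  rewrite /gD nMD /= eqEsubset -{1}defE mulgS ?subsetIr //=.
  by rewrite -defE -{1}defD mulgA (mulGSid sNP).
have /mingroupP[/andP[/negP ntN _] _] := minN; case: ntN.
rewrite -subG1 -tiNM subsetI subxx /= (subset_trans sND) //.
by rewrite -{1}eqD subsetIl.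
Qed.

(** Let T / F be a minimal normal subgroup of G / F, F the Fitting subgroup; it
    is a p-group.  With A the p'-part of F, which is abelian, and Q a Sylow
    p-subgroup of T one has T = A Q, and E = [A, Q], S = N_G(Q) work.  Indeed E is
    nontrivial since T is not nilpotent, G = A S by the Frattini argument, and
    A = E C_A(Q) with C_E(Q) = 1 by coprimality.  A supplement M of E contains a
    conjugate Q^e of Q, and the same argument inside M shows that it is
    generated by E :&: M and the normaliser of Q^e. *)
Lemma nonnilpotent_split : ~~ nilpotent G ->
  exists E S : {group gT},
   [/\ E <| G, abelian E, E :!=: 1, 'C_E(G) = 1 &
       supplements_split G E S].
Proof.
move=> not_nilG; set F := 'F(G)%G.
have nsFG: F <| G := Fitting_normal G.
have ntGF: G / F != 1.
  apply: contra not_nilG => /eqP/trivgP; rewrite quotient_sub1 ?normal_norm //.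
  by move=> sGF; apply: nilpotentS sGF (Fitting_nil G).
have [Tbar minT sTG] := minnormal_exists ntGF (normG _).
have [nTG _ /is_abelemP[p p_pr abelT]] :=
  minnormal_solvable minT sTG (quotient_sol F solG).
have [|T defTbar sFT nsTG] := @inv_quotientN _ _ G Tbar nsFG.
  by rewrite /normal sTG.
have pT: p.-group (T / F) by rewrite -defTbar (abelem_pgroup abelT).
have [sTsG nTsG] := andP nsTG.
have [Q sylQ] := Sylow_exists p T; have [sQT pQ _] := and3P sylQ.
have nFT: T \subset 'N(F) := subset_trans sTsG (normal_norm nsFG).
have defTFQ: T \subset F * Q.
  rewrite -quotientSK //.
  have := quotient_pHall (subset_trans sQT nFT) sylQ.
  by move/(pHall_id)=> -> //.
set A := 'O_p^'(F)%G.
have nsAG: A <| G by rewrite gFnormal_trans.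
have sAF: A \subset F := pcore_sub _ _.
have abA: abelian A.
  apply: nilpotent_normal_abelian nsAG _.
  exact: nilpotentS sAF (Fitting_nil G).
have [_ defF _ _] := dprodP (nilpotent_pcoreC p (Fitting_nil G : nilpotent F)).
have sOQ: 'O_p(F) \subset Q.
  apply: subset_trans (pcore_sub_Hall sylQ).
  apply: pcore_max (pcore_pgroup _ _) _.
  apply: normalS (subset_trans (pcore_sub _ _) sFT) sTsG _.
  by rewrite gFnormal_trans.
have defT: A * Q = T.
  apply/eqP; rewrite eqEsubset mul_subG ?(subset_trans sAF) //=.
  apply: subset_trans defTFQ _; rewrite -defF.
  have /dprodP[_ _ cAO _] := nilpotent_pcoreC p (Fitting_nil G : nilpotent F).
  by rewrite -(centC cAO) -mulgA (mulSGid sOQ).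
have nAG := normal_norm nsAG.
have sQG := subset_trans sQT sTsG.
have nAQ: Q \subset 'N(A) := subset_trans sQG nAG.
have coAQ: coprime #|A| #|Q|.
  by rewrite coprime_sym; apply: pnat_coprime pQ (pcore_pgroup _ _).
have solA := abelian_sol abA.
set S := 'N_G(Q)%G.
have defG: A * S = G.
  have sQS: Q \subset S by rewrite subsetI sQG normG.
  by rewrite -[RHS](Frattini_arg nsTG sylQ) -defT -mulgA (mulSGid sQS).
set E := [~: A, Q]%G.
have sEA: E \subset A by rewrite commg_subl.
have abE: abelian E := abelianS sEA abA.
have sSG: S \subset G := subsetIl _ _.
have nEG: G \subset 'N(E).
  rewrite -{1}defG mulG_subG commg_norml /= normsR //.
    exact: subset_trans sSG nAG.
  exact: subsetIr.
have sEG: E \subset G := subset_trans sEA (normal_sub nsAG).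
have defA : E * 'C_A(Q) = A := coprime_commg_cent nAQ coAQ solA.
have defES: E * S = G.
  apply/eqP; rewrite eqEsubset mul_subG //= -{1}defG -{1}defA -mulgA mulgS //.
  by apply: mul_subG => //; apply: setISS (normal_sub nsAG) (cent_sub Q).
have tiEQ: 'C_E(Q) = 1 by apply: coprime_abel_cent_TI.
exists E, S; split=> //.
- exact/andP.
- apply: contra not_nilG => /eqP/commG1P cAQ.
  have nilT: nilpotent T.
    rewrite -defT mulg_nil ?(abelian_nil abA) ?(pgroup_nil pQ) //.
    by rewrite centsC.
  have sTF: T \subset F by apply: Fitting_max.
  have /mingroupP[/andP[/negP ntT _] _] := minT; case: ntT.
  by rewrite defTbar -subG1 quotient_sub1.
- by apply/trivgP; rewrite -tiEQ setIS // centS.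
move=> M sMG defEM.
have sET: E \subset T by rewrite -defT (subset_trans sEA) ?mulG_subl.
have defT2: E * (M :&: T) = T by rewrite group_modl // defEM (setIidPr sTsG).
have coEp: p^'.-group E by apply: pgroupS sEA (pcore_pgroup _ _).
have [Q1 sylQ1] := Sylow_exists p (M :&: T).
have [sQ1 pQ1 _] := and3P sylQ1; have [sQ1M sQ1T] := subsetIP sQ1.
have sMTG: M :&: T \subset G by rewrite subIset ?sMG.
(* The index of M :&: T in T divides the order of the p'-group E. *)
have sylTQ1: p.-Sylow(T) Q1.
  rewrite /pHall sQ1T pQ1 /= -(Lagrange_index (subsetIr M T) sQ1) pnatM.
  have [_ _ ->] := and3P sylQ1; rewrite andbT.
  rewrite -{1}defT2 -normC ?(subset_trans sMTG) //.
  by rewrite indexMg -indexgI (pnat_dvd (dvdn_indexg _ _)).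
(* T = Q C_A(Q) E, where Q and C_A(Q) normalise Q. *)
have [e Ee defQ1]: exists2 e, e \in E & Q1 :=: Q :^ e.
  have [t Tt defQ1] := Sylow_trans sylQ sylTQ1.
  move: Tt; rewrite -defT -(normC nAQ) -defA => /mulsgP[q a Qq].
  rewrite -normC; last first.
    by rewrite (subset_trans (subset_trans (subsetIl _ _) (normal_sub nsAG))).
  case/mulsgP=> c e /setIP[_ cQc] Ee -> def_t.
  exists e => //; rewrite defQ1 def_t /= !conjsgM conjGid //.
  by rewrite (normP (subsetP (cent_sub Q) c cQc)).
have Ge := subsetP sEG e Ee.
have defSe: S :^ e = 'N_G(Q1) by rewrite conjIg conjGid // -normJ defQ1.
(* Since E is fixed by conjugation with e, the role of Q can be given to Q1. *)
have defEQ1: [~: A, Q1] = E.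
  by rewrite defQ1 -{1}(conjGid (subsetP sEA e Ee)) -conjsRg conjGid.
have nAQ1: Q1 \subset 'N(A) by rewrite (subset_trans sQ1T) ?(subset_trans sTsG).
have coAQ1: coprime #|A| #|Q1| by rewrite defQ1 cardJg.
have nEQ1: Q1 \subset 'N(E) by rewrite (subset_trans sQ1M) ?(subset_trans sMG).
have tiNEQ1: 'N_E(Q1) = 1.
  have tiCQ1: 'C_E(Q1) = 1.
    by have:= coprime_abel_cent_TI nAQ1 coAQ1 abA; rewrite defEQ1.
  apply/trivgP; rewrite -tiCQ1 subsetI subsetIl /=; apply/commG1P/trivgP.
  rewrite -(coprime_TIg (coprimeSg sEA coAQ1)) subsetI.
  rewrite (subset_trans (commSg _ (subsetIl _ _))) ?commg_subl //=.
  by rewrite commg_subr subsetIr.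
have defT1: A * Q1 = T.
  rewrite -(conjGid (subsetP sET e Ee)) -defT conjsMg -defQ1 conjGid //.
  exact: (subsetP sEA).
have defMT: (M :&: A) * Q1 = M :&: T by rewrite group_modr // defT1.
have sMAA : M :&: A \subset A := subsetIr _ _.
have nMAQ1: Q1 \subset 'N(M :&: A) by rewrite normsI // (subset_trans sQ1M) ?normG.
have defMA := coprime_commg_cent nMAQ1 (coprimeSg sMAA coAQ1) (solvableS sMAA solA).
have sMTM: M :&: T <| M.
  by rewrite /normal subsetIl normsI ?normG // (subset_trans sMG).
have defFr: (M :&: T) * 'N_M(Q1) = M := Frattini_arg sMTM sylQ1.
have defM: (E :&: M) * 'N_M(Q1) = M.
  apply/eqP; rewrite eqEsubset mul_subG ?subsetIl ?subsetIr //=.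
  rewrite -{1}defFr -defMT -defMA -!mulgA mulgSS //.
    rewrite subsetI -{1}defEQ1 commSg //= (subset_trans _ (subsetIl M A)) //.
    by rewrite commg_subl.
  rewrite !mul_subG // ?setISS ?cent_sub ?subsetIl //.
  by rewrite subsetI sQ1M normG.
exists e => //; rewrite defSe -[RHS]defM; congr (_ * _).
apply/eqP; rewrite eqEsubset andbC setSI //= subsetI subsetIr andbT.
apply/subsetP=> g /setIP[Gg nQ1g].
have: g \in E * 'N_M(Q1).
  rewrite -(mulGSid (subsetIl E M)) -mulgA defM defEM //.
case/mulsgP=> z m Ez /setIP[Mm nQ1m] def_g.
suffices z1: z = 1 by rewrite def_g z1 mul1g.
apply/set1P; rewrite -[[set 1]]tiNEQ1 inE Ez.
by rewrite -(groupMr _ nQ1m) -def_g.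
Qed.

End AllComplemented.

(** * Corrections that fail *)

Section Bad.

Variables (gT : finGroupType) (G N : {group gT}).
Hypotheses (minN : minnormal N G) (sNG : N \subset G) (abelN : abelian N).
Implicit Types (H K L M : {group gT}) (X Z : {set gT}).

Local Notation compl := [complements to N in G].

Lemma entries_const (y : gT) : entries (fun _ : 'I_1 => y) = [set y].
Proof.
apply/setP=> z; rewrite inE; apply/imsetP/eqP=> [[i _ ->] // | ->].
by exists ord0.
Qed.

Lemma gaschutz1 Z y y0 : Z \subset G -> y0 \in G -> <<y0 |: Z>> = G ->
    y \in G -> N * <<y |: Z>> = G ->
  exists2 n, n \in N & <<(y * n) |: Z>> = G.
Proof.
rewrite ![_ |: Z]setUC -!entries_const => sZG Gy0 gen0 Gy geny.
have sG z : z \in G -> entries (fun _ : 'I_1 => z) \subset G.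
  by rewrite entries_const sub1set.
have [n Nn gen] := gaschutz minN sNG abelN sZG (sG _ Gy0) gen0 (sG _ Gy) geny.
exists (n ord0) => //; rewrite setUC -gen; congr <<_ :|: _>>.
by rewrite -entries_const; apply: eq_imset => i; rewrite [i]ord1.
Qed.

Lemma gen_mulN1 Z y n : Z \subset G -> y \in G -> n \in N ->
  N * <<y |: Z>> = G -> N * <<(y * n) |: Z>> = G.
Proof.
rewrite ![_ |: Z]setUC -!entries_const => sZG Gy Nn gen.
have sYG: entries (fun _ : 'I_1 => y) \subset G by rewrite entries_const sub1set.
exact: (gen_mulN minN sNG sZG sYG (fun _ : 'I_1 => Nn) gen).
Qed.

(** The corrections n for which y * n and Z lie in a common complement of N,
    that is, fail to generate G ([bad_gen]). *)
Definition bad Z y :=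
  [set n in N | [exists M : {group gT}, [&& M \in compl, Z \subset M & y * n \in M]]].

Lemma badP Z y n : reflect
  (n \in N /\ exists M, [/\ M \in compl, Z \subset M & y * n \in M])
  (n \in bad Z y).
Proof.
rewrite inE; apply: (iffP andP) => [[-> /existsP[M /and3P[*]]] | [-> [M [*]]]].
  by split=> //; exists M.
by split=> //; apply/existsP; exists M; apply/and3P.
Qed.

Lemma bad_sub Z y : bad Z y \subset N.
Proof. by apply/subsetP=> n; rewrite inE => /andP[]. Qed.

Lemma bad_gen Z y n : Z \subset G -> y \in G -> N * <<y |: Z>> = G -> n \in N ->
  (n \in bad Z y) = (<<(y * n) |: Z>> != G).
Proof.
move=> sZG Gy geny Nn; have sG: (y * n) |: Z \subset G.
  by rewrite subUset sub1set groupM // (subsetP sNG).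
apply/badP/idP=> [[_ [M [cM sZM Myn]]] | neqG].
  apply/eqP=> eqG; have sGM: G \subset M by rewrite -eqG gen_subG subUset sub1set Myn.
  have /complP[tiM _] := cM; have /mingroupP[/andP[/negP ntN _] _] := minN.
  by case: ntN; rewrite -subG1 -tiM subsetI subxx (subset_trans sNG).
have [eqG | cH] := gen_supplement minN abelN sG (gen_mulN1 sZG Gy Nn geny).
  by rewrite eqG eqxx in neqG.
split=> //; set Zn := (y * n) |: Z in cH; exists <<Zn>>%G; split=> //=.
  by rewrite (subset_trans _ (subset_gen _)) ?subsetUr.
by rewrite mem_gen ?setU11.
Qed.

Lemma bad_shift Z y n0 n : n0 \in N ->
  (n0 * n \in bad Z y) = (n \in bad Z (y * n0)).
Proof. by move=> Nn0; rewrite !inE groupMl // mulgA. Qed.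

Lemma bad_shiftE Z y n0 : n0 \in N -> bad Z y = n0 *: bad Z (y * n0).
Proof.
by move=> Nn0; apply/setP=> n; rewrite mem_lcoset -bad_shift // mulKVg.
Qed.

(** A base point M0 over Z and y exists because 1 is bad. *)
Lemma bad_group Z y : 1 \in bad Z y -> group_set (bad Z y).
Proof.
move=> bad1; have /badP[_ [M0 [cM0 sZM0 My]]] := bad1; rewrite mulg1 in My.
have badV n n' : n \in bad Z y -> n' \in bad Z y -> n * n'^-1 \in bad Z y.
  case/badP=> Nn [M [cM sZM Myn]] /badP[Nn' [M' [cM' sZM' Myn']]].
  have [M'' cM'' defM''] := cofactor_quotient minN sNG abelN cM0 cM cM'.
  apply/badP; rewrite groupM ?groupV //; split=> //; exists M''; split=> //.
    apply/subsetP=> z Zz; rewrite -[z]mulg1 -[1](mulgV 1).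
    by apply: defM''; rewrite ?group1 ?mulg1 //; apply: (subsetP _ z Zz).
  exact: defM''.
apply/group_setP; split=> // n n' badn badn'; rewrite -[n']invgK.
by rewrite badV // -[n'^-1]mul1g badV.
Qed.

(** Over a base point containing y, G-endomorphisms of N act on complements. *)
Lemma bad_endo Z y (f : gT -> gT) n : 1 \in bad Z y ->
    {in N, forall n, f n \in N} -> {in N &, {morph f : n n' / n * n'}} ->
    {in N & G, forall n g, f (n ^ g) = f n ^ g} ->
  n \in bad Z y -> f n \in bad Z y.
Proof.
move=> /badP[_ [M0 [cM0 sZM0 My]]] Nf fM fJ /badP[Nn [M [cM sZM Myn]]].
rewrite mulg1 in My.
have f1: f 1 = 1.
  have:= fM 1 1 (group1 _) (group1 _); rewrite mulg1 => /eqP.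
  by rewrite eq_mulVg1 mulKg => /eqP.
have [M' cM' defM'] := cofactor_endo minN sNG cM0 cM Nf fM fJ.
apply/badP; split; first exact: Nf.
exists M'; split; rewrite ?defM' //.
apply/subsetP=> z Zz; rewrite -[z]mulg1 -f1 defM' ?mulg1 ?group1 //.
  exact: (subsetP sZM0).
exact: (subsetP sZM).
Qed.

(** A nonempty set of bad corrections is a translate of a subgroup of N, namely
    of the bad corrections of y * n for any bad n; the index of this subgroup
    bounds the proportion of bad corrections. *)
Lemma card_bad Z y k : bad Z y != N -> 
   (forall n, n \in bad Z y -> forall W : {group gT},
      W :=: bad Z (y * n) -> W \proper N -> #|N : W| >= k) ->
  #|bad Z y| * k <= #|N|.
Proof.
move=> neqN indexW; have [-> | [n0 badn0]] := set_0Vmem (bad Z y).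
  by rewrite cards0.
have Nn0 := subsetP (bad_sub Z y) n0 badn0.
have gW: group_set (bad Z (y * n0)).
  by apply: bad_group; rewrite -bad_shift // mulg1.
have defW := bad_shiftE Z y Nn0.
have pW: Group gW \proper N.
  rewrite properEneq bad_sub andbT; apply: contraNneq neqN => eqN.
  by rewrite defW (_ : bad Z (y * n0) = N) ?lcoset_id.
rewrite defW card_lcoset -(LagrangeI N (Group gW)).
rewrite (setIidPr (proper_sub pW)) leq_mul2l.
by rewrite (indexW n0 badn0 (Group gW)) ?orbT.
Qed.

Lemma card_bad2 Z y : bad Z y != N -> #|bad Z y| * 2 <= #|N|.
Proof.
move=> neqN; apply: card_bad => // n _ W _ /andP[_ not_sNW].
by rewrite indexg_gt1.
Qed.

Section CommonLift.

Variable b : nat.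
Implicit Types (Y n : 'I_b -> gT).

(** Correct Y into M0 first.  Then the bad corrections for X1, and those for X2,
    are closed under quotients and both are proper by Gaschuetz' lemma; as with
    two proper subgroups, they do not cover all corrections. *)
Lemma common_lift M0 X1 X2 Y1 Y2 Y : M0 \in compl ->
    X1 \subset M0 -> X2 \subset M0 ->
    entries Y1 \subset G -> entries Y2 \subset G ->
    <<X1 :|: entries Y1>> = G -> <<X2 :|: entries Y2>> = G ->
    entries Y \subset G ->
    N * <<X1 :|: entries Y>> = G -> N * <<X2 :|: entries Y>> = G ->
  exists n : 'I_b -> gT, [/\ forall i, n i \in N,
    <<X1 :|: entries (fun i => Y i * n i)>> = G
  & <<X2 :|: entries (fun i => Y i * n i)>> = G].
Proof.
move=> cM0 sX1 sX2 sY1 sY2 gen1 gen2 sY genY1 genY2.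
have sM0G := compl_sub cM0.
have sX1G := subset_trans sX1 sM0G; have sX2G := subset_trans sX2 sM0G.
have GY i : Y i \in G by apply/entries_subP: i.
pose n0 i := cofactor N M0 (Y i).
have Nn0 i : n0 i \in N by apply: (mem_cofactor minN cM0).
pose Y0 i := Y i * n0 i.
have MY0 i : Y0 i \in M0 by apply: (mul_cofactor cM0).
have sY0G: entries Y0 \subset G.
  by apply/entries_subP=> i; apply: (subsetP sM0G).
have shift n : entries (fun i => Y i * (n0 i * n i)) = entries (fun i => Y0 i * n i).
  by apply: eq_imset => i; rewrite mulgA.
have gen01: N * <<X1 :|: entries Y0>> = G by apply: (gen_mulN minN).
have gen02: N * <<X2 :|: entries Y0>> = G by apply: (gen_mulN minN).
pose isbad X n := exists M,
  [/\ M \in compl, X \subset M & entries (fun i => Y0 i * n i) \subset M].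
have badP1 X n : X \subset M0 -> N * <<X :|: entries Y0>> = G ->
   (forall i, n i \in N) ->
   <<X :|: entries (fun i => Y0 i * n i)>> = G \/ isbad X n.
  move=> sXM genX Nn; have sXG := subset_trans sXM sM0G.
  have sG: X :|: entries (fun i => Y0 i * n i) \subset G.
    rewrite subUset sXG; apply/entries_subP=> i.
    exact: groupM (entries_subP _ _ sY0G i) (subsetP sNG _ (Nn i)).
  have [|cH] := gen_supplement minN abelN sG (gen_mulN minN sNG sXG sY0G Nn genX).
    by left.
  right; set Z := X :|: entries _ in cH; exists <<Z>>%G; split=> //=.
    by rewrite (subset_trans _ (subset_gen _)) ?subsetUl.
  by rewrite (subset_trans _ (subset_gen _)) ?subsetUr.
have not_bad X n : <<X :|: entries (fun i => Y0 i * n i)>> = G -> ~ isbad X n.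
  move=> genX [M [cM sXM sYM]].
  have sGM: G \subset M by rewrite -genX gen_subG subUset sXM.
  have /complP[tiM _] := cM; have /mingroupP[/andP[/negP ntN _] _] := minN.
  by case: ntN; rewrite -subG1 -tiM subsetI subxx (subset_trans sNG).
have badV X n n' : X \subset M0 -> (forall i, n i \in N) -> (forall i, n' i \in N) ->
   isbad X n -> isbad X n' -> isbad X (fun i => n i * (n' i)^-1).
  move=> sXM0 Nn Nn' [M [cM sXM /entries_subP Mn]] [M' [cM' sXM' /entries_subP Mn']].
  have [M'' cM'' defM''] := cofactor_quotient minN sNG abelN cM0 cM cM'.
  exists M''; split=> //.
    apply/subsetP=> z Zz; rewrite -[z]mulg1 -[1](mulgV 1).
    by apply: defM''; rewrite ?group1 ?mulg1 //; apply: (subsetP _ z Zz).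
  by apply/entries_subP=> i; apply: defM''.
have [n1 Nn1 good1] := gaschutz minN sNG abelN sX1G sY1 gen1 sY0G gen01.
have [n2 Nn2 good2] := gaschutz minN sNG abelN sX2G sY2 gen2 sY0G gen02.
suffices [n [Nn g1 g2]]: exists n, [/\ forall i, n i \in N,
    <<X1 :|: entries (fun i => Y0 i * n i)>> = G
  & <<X2 :|: entries (fun i => Y0 i * n i)>> = G].
  exists (fun i => n0 i * n i); rewrite shift; split=> // i.
  by rewrite groupM.
have [|bad21] := badP1 X2 n1 sX2 gen02 Nn1; first by exists n1.
have [|bad12] := badP1 X1 n2 sX1 gen01 Nn2; first by exists n2.
have Nn12 i : n1 i * n2 i \in N by rewrite groupM.
exists (fun i => n1 i * n2 i); split=> //.
  have [//|bad12'] := badP1 X1 _ sX1 gen01 Nn12.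
  case: (not_bad X1 n1 good1); have:= badV _ _ _ sX1 Nn12 Nn2 bad12' bad12.
  case=> M [cM sXM sYM]; exists M; split=> //.
  by apply: subset_trans sYM; apply/subsetP=> _ /imsetP[i _ ->];
    apply/imsetP; exists i; rewrite ?mulgK.
have [//|bad12'] := badP1 X2 _ sX2 gen02 Nn12.
case: (not_bad X2 n2 good2); have:= badV _ _ _ sX2 Nn12 Nn1 bad12' bad21.
case=> M [cM sXM sYM]; exists M; split=> //.
apply: subset_trans sYM; apply/subsetP=> _ /imsetP[i _ ->].
apply/imsetP; exists i; rewrite // (centsP abelN (n1 i) _ (n2 i)) //.
by rewrite mulgK.
Qed.

End CommonLift.

End Bad.

(** * Normal complements inside an abelian normal subgroup *)

Lemma solvable_minnormal_abelian (gT : finGroupType) (G N : {group gT}) :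
  solvable G -> minnormal N G -> N \subset G -> abelian N.
Proof.
move=> solG minN sNG; have [_ _ /is_abelemP[p _ abelN]] :=
  minnormal_solvable minN sNG solG.
exact: abelem_abelian abelN.
Qed.

Lemma minnormal_neq1 (gT : finGroupType) (G N : {group gT}) :
  minnormal N G -> N :!=: 1.
Proof. by case/mingroupP=> /andP[]. Qed.

Section Complement.

Variables (gT : finGroupType) (G : {group gT}).
Implicit Types (D E K M N P S : {group gT}) (X : {set gT}).

Definition normal_compl E N :=
  [set D : {group gT} | [&& D <| G, N * D == E & N :&: D == 1]].

Lemma normal_complP E N D :
  reflect [/\ D <| G, N * D = E & N :&: D = 1] (D \in normal_compl E N).
Proof. by rewrite inE; apply: (iffP and3P) => -[? /eqP ? /eqP ?]. Qed.

(** A nontrivial element of X generates a normal subgroup, which contains some N;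
    then N is contained in every complement over X. *)
Lemma abelian_compl_over X : abelian G -> X \subset G ->
    (forall N, minnormal N G -> N \subset G ->
       exists2 M, M \in [complements to N in G] & X \subset M) ->
  X \subset [set 1].
Proof.
move=> abG sXG complX; apply/subsetP=> x Xx; rewrite inE; apply: contraT => ntx.
have sxG: <[x]> \subset G by rewrite cycle_subG (subsetP sXG).
have [||N minN sNx] := minnormal_exists (G := G) (H := <[x]>%G).
- by rewrite cycle_eq1.
- exact: subset_trans (sub_abelian_cent abG sxG) (cent_sub _).
have [M /complP[tiM _] sXM] := complX N minN (subset_trans sNx sxG).
case/negP: (minnormal_neq1 minN); rewrite -subG1 -tiM subsetI subxx /=.
by rewrite (subset_trans sNx) // cycle_subG (subsetP sXM).
Qed.

(** Take S minimal among the subgroups over X that supplement E.  If S met E, it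
    would contain some N <= E, and a complement of N over X would cut S down. *)
Lemma compl_over_abelian E X : E <| G -> abelian E -> X \subset G ->
    (forall N, minnormal N G -> N \subset E ->
       exists2 M, M \in [complements to N in G] & X \subset M) ->
  exists S, [/\ S \subset G, X \subset S, E * S = G & E :&: S = 1].
Proof.
move=> nsEG abE sXG complX; have [sEG nEG] := andP nsEG.
pose gS (S : {group gT}) := [&& S \subset G, X \subset S & E * S == G].
have [|S] := @ex_mingroup _ gS.
  by exists G; rewrite /gS subxx sXG mulSGid /=.
case/mingroupP=> /and3P[sSG sXS /eqP defG] minS.
exists S; split=> //; apply/eqP; apply: contraT => ntES.
have nESG: G \subset 'N(E :&: S).
  rewrite -{1}defG mulG_subG (normsI _ (normG S)) ?(subset_trans sSG) // andbT.
  exact: subset_trans (sub_abelian_cent abE (subsetIl _ _)) (cent_sub _).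
have [N minN /subsetIP[sNE sNS]] := minnormal_exists ntES nESG.
have [M /complP[tiM defGM] sXM] := complX N minN sNE.
have defS: N * (M :&: S) = S by rewrite group_modl // defGM (setIidPr sSG).
have eqS: M :&: S = S.
  apply: (minS (M :&: S)%G); last exact: subsetIr.
  rewrite /gS /= subsetI sXM sXS subIset ?sSG ?orbT //=.
  by rewrite -defG -{2}defS mulgA (mulGSid sNE).
case/negP: (minnormal_neq1 minN); rewrite -subG1 -tiM subsetI subxx /=.
by rewrite (subset_trans sNS) // -{1}eqS subsetIl.
Qed.

Section Split.

Variables (E S : {group gT}).
Hypotheses (nsEG : E <| G) (abE : abelian E) (sSG : S \subset G).
Hypotheses (defG : E * S = G) (tiES : E :&: S = 1).

Lemma minnormal_in_abelian N : N \subset E -> N \subset G.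
Proof. by move/subset_trans; apply; apply: normal_sub. Qed.

(** E :&: D S = D (E :&: S) = D. *)
Lemma normal_compl_join N D : N \subset E -> D \in normal_compl E N ->
  (D <*> S)%G \in [complements to N in G].
Proof.
move=> sNE /normal_complP[nsDG defE tiND]; have [sDG nDG] := andP nsDG.
have sDE: D \subset E by rewrite -defE mulG_subr.
have defDS: D <*> S = D * S by rewrite norm_joinEr ?(subset_trans sSG).
apply/complP; split; last by rewrite /= defDS mulgA defE defG.
apply/trivgP; rewrite -tiND subsetI subsetIl /= defDS.
apply: subset_trans (setSI _ sNE) _.
by rewrite setIC -group_modl // [S :&: E]setIC tiES mulg1.
Qed.

Hypothesis complG : forall N, minnormal N G -> N \subset G ->
  exists M, M \in [complements to N in G].

(** Split E as P D and choose N in D; then split E once more, along P N. *)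
Lemma proper_normal_compl P : P <| G -> P \proper E ->
  exists N D, [/\ minnormal N G, N \subset E, D \in normal_compl E N & P \subset D].
Proof.
move=> nsPG /andP[sPE not_sEP]; have [sPG nPG] := andP nsPG.
have [D [nsDG defE tiPD]] := normal_abelian_split complG nsEG abE nsPG sPE.
have ntD: D :!=: 1.
  by apply: contraNneq not_sEP => D1; rewrite -defE D1 mulg1.
have [N minN sND] := minnormal_exists ntD (normal_norm nsDG).
have sNE: N \subset E by rewrite (subset_trans sND) // -defE mulG_subr.
have nNG := minnormal_norm minN.
have tiPN: P :&: N = 1 by apply/trivgP; rewrite -tiPD setIS.
have sNG := minnormal_in_abelian sNE.
have nsPNG: P <*> N <| G by rewrite normalY // /normal sNG.
have defPN: P <*> N = P * N by rewrite norm_joinEr // (subset_trans sNG).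
have [|D1 [nsD1G defE1 tiD1]] := normal_abelian_split complG nsEG abE nsPNG.
  by rewrite join_subG sPE.
have defPD1: P <*> D1 = P * D1.
  by rewrite norm_joinEr // (subset_trans (normal_sub nsD1G)).
exists N, (P <*> D1)%G; split=> //; last exact: joing_subl.
apply/normal_complP; split=> /=; first by rewrite normalY.
  by rewrite defPD1 mulgA [N * P]normC ?(subset_trans sNG) // -defPN defE1.
apply/trivgP/subsetP=> n; rewrite /= defPD1 => /setIP[Nn].
case/mulsgP=> p d Pp Dd def_n.
have d1: d = 1.
  apply/set1P; rewrite -[[set 1]]tiD1 inE Dd andbT /= defPN.
  by apply/mulsgP; exists p^-1 n; rewrite ?groupV // def_n mulKg.
by rewrite -tiPN inE Nn andbT def_n d1 mulg1.
Qed.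

(** The hypothesis says that e has the same projection to N along D1 and D2.
    Then e lies in N (D1 :&: D2), which is normal in G, so this is all of E. *)
Lemma normal_compl_inj N D1 D2 e n : D1 \in normal_compl E N ->
    D2 \in normal_compl E N -> N \subset E -> G \subset 'N(N) ->
    <<e ^: G>> = E -> n \in N -> e * n \in D1 -> e * n \in D2 ->
  D1 = D2.
Proof.
move=> ED1 ED2 sNE nNG genE Nn D1e D2e.
have [/andP[sD1G nD1G] defE1 ti1] := normal_complP _ _ _ ED1.
have [/andP[sD2G nD2G] defE2 ti2] := normal_complP _ _ _ ED2.
have nDG: G \subset 'N(D1 :&: D2) by rewrite normsI.
have sNG := minnormal_in_abelian sNE.
have defK: N <*> (D1 :&: D2) = N * (D1 :&: D2).
  by rewrite norm_joinEr // (subset_trans _ nNG) // subIset ?sD1G.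
have sEK: E \subset N * (D1 :&: D2).
  rewrite -defK -genE gen_subG class_sub_norm ?normsY //.
  rewrite -[e](mulgK n) groupM //.
    by apply: (subsetP (joing_subr _ _)); rewrite inE D1e.
  by rewrite groupV (subsetP (joing_subl _ _)).
suffices sub12 D D' : D \subset E -> N :&: D = 1 ->
    N * (D' :&: D) = E -> D \subset D'.
  have defE: N * (D1 :&: D2) = E.
    apply/eqP; rewrite eqEsubset sEK mul_subG // subIset // -defE1.
    by rewrite mulG_subr.
  have sD1E: D1 \subset E by rewrite -defE1 mulG_subr.
  have sD2E: D2 \subset E by rewrite -defE2 mulG_subr.
  have sD12: D1 \subset D2 by apply: sub12 sD1E ti1 _; rewrite setIC.
  have sD21: D2 \subset D1 := sub12 D2 D1 sD2E ti2 defE.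
  by apply/group_inj/eqP; rewrite eqEsubset sD12.
move=> sDE tiND defE; rewrite -(setIidPr sDE) -{1}defE setIC -group_modr ?subsetIr //.
by rewrite setIC tiND mul1g subsetIl.
Qed.

(** The conjugating element can be taken in N, since E = (E :&: M) N and E :&: M
    normalises (E :&: M) S. *)
Lemma compl_conj_join N M : minnormal N G -> N \subset E ->
    supplements_split G E S ->
    M \in [complements to N in G] ->
  (E :&: M)%G \in normal_compl E N /\
  exists2 v, v \in N & M :=: ((E :&: M) * S) :^ v.
Proof.
move=> minN sNE supE cM; have /complP[tiNM defNM] := cM.
have sMG := compl_sub cM; have [sEG nEG] := andP nsEG.
have defEM: E * M = G.
  by apply/eqP; rewrite eqEsubset mul_subG //= -{1}defNM mulSg.
have defE: N * (E :&: M) = E.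
  by rewrite setIC group_modl // defNM (setIidPr sEG).
have nDG: G \subset 'N(E :&: M).
  rewrite -{1}defEM mulG_subG (normsI _ (normG M)) ?(subset_trans sMG) // andbT.
  exact: subset_trans (sub_abelian_cent abE (subsetIl _ _)) (cent_sub _).
split.
  apply/normal_complP; split=> //=; last by rewrite setIA (setIidPl sNE).
  by rewrite /normal subIset ?sEG.
have [e Ee defM] := supE M sMG defEM.
have: e \in (E :&: M) * N by rewrite (centC _) ?defE // centsC (sub_abelian_cent2 abE) ?subsetIl.
case/mulsgP=> d v Dd Nv def_e; exists v => //.
have Gv: v \in G by rewrite (subsetP sEG) ?(subsetP sNE).
have defDS: (E :&: M) * S = (E :&: M) <*> S.
  by rewrite norm_joinEr // (subset_trans sSG).
have Gd: d \in (E :&: M) <*> S by rewrite (subsetP (joing_subl _ _)).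
have eq_d: ((E :&: M) * S) :^ d = (E :&: M) * S by rewrite defDS conjGid.
have Ge := subsetP sEG e Ee.
by rewrite -eq_d -conjsgM -def_e conjsMg (normsP nDG e Ge) defM.
Qed.

Lemma leq_card_compl N : minnormal N G -> N \subset E ->
    supplements_split G E S ->
  #|[complements to N in G]| <= #|normal_compl E N| * #|N|.
Proof.
move=> minN sNE supE; rewrite -cardsX.
pose h (u : {group gT} * gT) := ((u.1 <*> S) :^ u.2)%G.
apply: leq_trans (leq_imset_card h _); apply/subset_leq_card/subsetP=> M cM.
have [ED [v Nv defM]] := compl_conj_join minN sNE supE cM.
apply/imsetP; exists ((E :&: M)%G, v); first by rewrite inE ED.
apply/val_inj; rewrite /= {1}defM norm_joinEr //.
have [/andP[_ nDG] _ _] := normal_complP _ _ _ ED.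
exact: subset_trans sSG nDG.
Qed.

End Split.

End Complement.

(** * Common neighbours: a minimal failure *)

Section Common.

Variables (gT : finGroupType) (G : {group gT}) (b : nat).
Hypothesis solG : solvable G.
Implicit Types (D E K M N P S : {group gT}) (X : {set gT}) (Y : 'I_b -> gT).

Definition has_neighbour X :=
  exists Y, entries Y \subset G /\ <<X :|: entries Y>> = G.

(** The subgroup K stands for a generation condition modulo K; K = 1 gives
    neighbours in the graph itself. *)
Definition common_neighbour_mod (K : {set gT}) X1 X2 :=
  exists Y, [/\ entries Y \subset G, K * <<X1 :|: entries Y>> = G
              & K * <<X2 :|: entries Y>> = G].

Lemma common_neighbour_modC K X1 X2 :
  common_neighbour_mod K X1 X2 -> common_neighbour_mod K X2 X1.
Proof. by case=> Y [*]; exists Y. Qed.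

(** The endomorphisms of N as a G-module under conjugation. *)
Definition conj_End (N : {set gT}) : {set {ffun gT -> gT}} :=
  [set f : {ffun gT -> gT} | [&& f \in pffun_on 1 N N, morphic N f
     & [forall v in N, forall g in G, f (v ^ g) == f v ^ g]]].

Section Stuck.

Variables (X1 X2 : {set gT}) (N : {group gT}).
Hypotheses (sX1G : X1 \subset G) (sX2G : X2 \subset G).
Hypotheses (nb1 : has_neighbour X1) (nb2 : has_neighbour X2).
Hypotheses (minN : minnormal N G) (sNG : N \subset G).
Hypotheses (modN : common_neighbour_mod N X1 X2).
Hypothesis stuck : ~ common_neighbour_mod 1 X1 X2.

Let abelN : abelian N := solvable_minnormal_abelian solG minN sNG.

Lemma no_compl_over_gen X Y : X \subset G -> entries Y \subset G ->
    N * <<X :|: entries Y>> = G ->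
    ~ (exists2 M, M \in [complements to N in G] & X \subset M) ->
  <<X :|: entries Y>> = G.
Proof.
move=> sXG sYG genX noM; have sG: X :|: entries Y \subset G by rewrite subUset sXG.
have [//|cH] := gen_supplement minN abelN sG genX; case: noM.
set Z := X :|: entries Y in cH; exists <<Z>>%G => //=.
by rewrite (subset_trans _ (subset_gen _)) ?subsetUl.
Qed.

(** Otherwise every correction is good for X1, and Gaschuetz' lemma provides one
    that is good for X2. *)
Lemma stuck_compl_over :
  exists2 M, M \in [complements to N in G] & X1 \subset M.
Proof.
have: (exists2 M, M \in [complements to N in G] & X1 \subset M) \/
   ~ (exists2 M, M \in [complements to N in G] & X1 \subset M).
  case: (boolP [exists M : {group gT}, (M \in [complements to N in G]) && (X1 \subset M)]).
    by case/existsP=> M /andP[]; left; exists M.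
  move/existsP=> noM; right=> -[M cM sXM]; case: noM; exists M; exact/andP.
case=> // noM; case: stuck.
have [Y [sYG gen1 gen2]] := modN; have [Y0 [sY0G gen0]] := nb2.
have [n Nn good2] := gaschutz minN sNG abelN sX2G sY0G gen0 sYG gen2.
have sYnG: entries (fun i => Y i * n i) \subset G.
  apply/entries_subP=> i; rewrite groupM ?(subsetP sNG _ (Nn i)) //.
  exact: (entries_subP _ _ sYG).
exists (fun i => Y i * n i); rewrite !mul1g; split=> //.
by apply: no_compl_over_gen noM => //; apply: gen_mulN.
Qed.

Lemma stuck_common_compl M : M \in [complements to N in G] ->
  X1 \subset M -> X2 \subset M -> False.
Proof.
move=> cM sX1 sX2; case: stuck; have [Y [sYG gen1 gen2]] := modN.
have [[Y1 [sY1 gen01]] [Y2 [sY2 gen02]]] := (nb1, nb2).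
have [n [Nn good1 good2]] := common_lift minN sNG abelN cM sX1 sX2 sY1 sY2
  gen01 gen02 sYG gen1 gen2.
exists (fun i => Y i * n i); rewrite !mul1g; split=> //.
apply/entries_subP=> i; rewrite groupM ?(subsetP sNG _ (Nn i)) //.
exact: (entries_subP _ _ sYG).
Qed.

(** With fewer complements, some correction of Y alone avoids all of them. *)
Lemma stuck_card_compl : #|N| ^ b <= #|[complements to N in G]|.
Proof.
rewrite leqNgt; apply/negP=> ltcN; case: stuck.
have [Y [sYG gen1 gen2]] := modN.
have [n Nn avoid] := avoid_compl minN sYG (fun M cM => cM) ltcN.
have sYnG: entries (fun i => Y i * n i) \subset G.
  apply/entries_subP=> i; rewrite groupM ?(subsetP sNG _ (Nn i)) //.
  exact: (entries_subP _ _ sYG).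
have good X : X \subset G -> N * <<X :|: entries Y>> = G ->
    <<X :|: entries (fun i => Y i * n i)>> = G.
  move=> sXG genX; set Z := X :|: _.
  have sZG: Z \subset G by rewrite subUset sXG.
  have [//|cH] := gen_supplement minN abelN sZG (gen_mulN minN sNG sXG sYG Nn genX).
  case/negP: (avoid <<Z>>%G cH).
  by rewrite (subset_trans _ (subset_gen _)) ?subsetUr.
by exists (fun i => Y i * n i); rewrite !mul1g; split=> //; apply: good.
Qed.

End Stuck.

Section MinimalCounterexample.

Variables (X1 X2 : {set gT}).
Hypotheses (sX1G : X1 \subset G) (sX2G : X2 \subset G).
Hypotheses (nb1 : has_neighbour X1) (nb2 : has_neighbour X2).
Hypothesis modN : forall N, minnormal N G -> N \subset G ->
  common_neighbour_mod N X1 X2.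
Hypothesis stuck : ~ common_neighbour_mod 1 X1 X2.

Lemma mincex_compl1 N : minnormal N G -> N \subset G ->
  exists2 M, M \in [complements to N in G] & X1 \subset M.
Proof.
move=> minN sNG.
exact: (stuck_compl_over sX1G sX2G nb2 minN sNG (modN minN sNG) stuck).
Qed.

Lemma mincex_compl2 N : minnormal N G -> N \subset G ->
  exists2 M, M \in [complements to N in G] & X2 \subset M.
Proof.
move=> minN sNG; apply: (stuck_compl_over sX2G sX1G nb1 minN sNG).
  exact/common_neighbour_modC/modN.
by move/common_neighbour_modC.
Qed.

Lemma mincex_compl N : minnormal N G -> N \subset G ->
  exists M, M \in [complements to N in G].
Proof. by move=> minN sNG; have [M] := mincex_compl1 minN sNG; exists M. Qed.

(** Otherwise G is abelian and X1, X2 are trivial, so that any neighbour of X1 is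
    one of X2. *)
Lemma mincex_nonnilpotent : ~~ nilpotent G.
Proof.
apply/negP=> nilG; case: stuck.
have abG := nilpotent_normal_abelian mincex_compl (normal_refl G) nilG.
have sX1 := abelian_compl_over abG sX1G mincex_compl1.
have sX2 := abelian_compl_over abG sX2G mincex_compl2.
have [Y [sYG genY]] := nb1; exists Y; rewrite !mul1g; split=> //.
have gen1 X : X \subset [set 1] -> <<X :|: entries Y>> = <<entries Y>>.
  move=> sX; apply/eqP; rewrite eqEsubset andbC genS ?subsetUr //= gen_subG.
  by rewrite subUset subset_gen andbT (subset_trans sX) // sub1set group1.
by rewrite gen1 // -(gen1 X1).
Qed.

(** X1 and X2 lie in complements S1 and S2 = S1^e of E.  No normal complement of N
    in E contains e, so there are fewer than |N| of them and fewer than |N|^2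
    complements of N in G, contrary to [stuck_card_compl]. *)
Lemma mincex_length_lt2 : b < 2.
Proof.
rewrite ltnNge; apply/negP=> b_ge2.
have [E [S [nsEG abE ntE tiEC supE]]] :=
  nonnilpotent_split solG mincex_compl mincex_nonnilpotent.
have [sEG nEG] := andP nsEG.
have mE N : minnormal N G -> N \subset E -> N \subset G.
  by move=> _ sNE; apply: subset_trans sNE sEG.
have [S1 [sS1G sX1S1 defG1 tiES1]] := compl_over_abelian nsEG abE sX1G
  (fun N minN sNE => mincex_compl1 minN (mE N minN sNE)).
have [S2 [sS2G sX2S2 defG2 tiES2]] := compl_over_abelian nsEG abE sX2G
  (fun N minN sNE => mincex_compl2 minN (mE N minN sNE)).
have supE1 := supplements_split_compl supE sS1G defG1 tiES1.
have [e Ee] := supE1 S2 sS2G defG2; rewrite tiES2 mul1g => defS2.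
have not_De N D : minnormal N G -> N \subset E -> D \in normal_compl G E N ->
    e \notin D.
  move=> minN sNE ED; apply/negP=> De.
  have cM := normal_compl_join sS1G defG1 tiES1 sNE ED.
  apply: (stuck_common_compl nb1 nb2 minN (mE N minN sNE)
    (modN minN (mE N minN sNE)) stuck cM) => /=.
    by rewrite (subset_trans sX1S1) ?joing_subr.
  have eq_e: (D <*> S1) :^ e = D <*> S1.
    by rewrite conjGid // (subsetP (joing_subl _ _)).
  by rewrite (subset_trans sX2S2) // -defS2 -eq_e conjSg joing_subr.
have Ge := subsetP sEG e Ee.
(* A proper normal closure of e would lie in some normal complement. *)
have genE: <<e ^: G>> = E.
  apply/eqP; apply: contraT => neqE.
  have sPE: <<e ^: G>> \subset E by rewrite gen_subG class_sub_norm.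
  have nsPG: <<e ^: G>> <| G.
    rewrite /normal gen_subG class_subG //=.
    by rewrite (subset_trans _ (norm_gen _)) // class_norm.
  have [|N [D [minN sNE ED sPD]]] := proper_normal_compl nsEG abE mincex_compl nsPG.
    by rewrite properEneq neqE.
  case/negP: (not_De N D minN sNE ED); apply: (subsetP sPD).
  by rewrite mem_gen // class_refl.
have [N minN sNE] := minnormal_exists ntE nEG.
have sNG := mE N minN sNE; have nNG := minnormal_norm minN.
pose EN := normal_compl G E N.
have ED_NM D : D \in EN -> e \in D * N.
  case/normal_complP=> /andP[sDG _] defE _; rewrite normC ?defE //.
  exact: subset_trans sDG nNG.
(* The projections of e along the members of EN are distinct and nontrivial. *)
have card_EN: #|EN| < #|N|.
  pose pr D := remgr D N e.
  have injpr: {in EN &, injective pr}.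
    move=> D1 D2 ED1 ED2 eq_pr.
    have D1e := mem_divgr (ED_NM D1 ED1); have D2e := mem_divgr (ED_NM D2 ED2).
    have Ne: (pr D1)^-1 \in N by rewrite groupV mem_remgr ?ED_NM.
    rewrite /divgr -/(pr D2) -eq_pr in D2e.
    exact: (normal_compl_inj nsEG ED1 ED2 sNE nNG genE Ne D1e D2e).
  rewrite -(card_in_imset injpr) (cardsD1 1 N) group1 ltnS subset_leq_card //.
  apply/subsetP=> _ /imsetP[D ED ->]; rewrite !inE mem_remgr ?ED_NM // andbT.
  apply: contra (not_De N D minN sNE ED) => /eqP pr1.
  by have:= mem_divgr (ED_NM D ED); rewrite /divgr -/(pr D) pr1 invg1 mulg1.
have := leq_card_compl nsEG abE sS1G minN sNE supE1.
apply/negP; rewrite -ltnNge.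
apply: leq_trans (stuck_card_compl sX1G sX2G minN sNG (modN minN sNG) stuck).
apply: leq_trans (leq_pexp2l (cardG_gt0 N) b_ge2).
by rewrite expnS expn1 ltn_pmul2r.
Qed.

End MinimalCounterexample.

End Common.

(** * Common neighbours of length 1 *)

Section Endo.

Variables (gT : finGroupType) (G N : {group gT}).
Hypotheses (minN : minnormal N G) (sNG : N \subset G) (abelN : abelian N).

Lemma conj_EndP (f : {ffun gT -> gT}) : f \in conj_End G N ->
  [/\ {in N, forall n, f n \in N}, {in N &, {morph f : n n' / n * n'}},
      {in N & G, forall n g, f (n ^ g) = f n ^ g} & {in [predC N], forall n, f n = 1}].
Proof.
rewrite inE => /and3P[/pffun_onP[supf Nf] /morphicP fM /'forall_in_forall_inP fJ].
split=> //.
- by move=> n Nn; apply: Nf; apply: image_f.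
- by move=> n g Nn Gg; apply/eqP/fJ.
move=> n; rewrite inE => not_Nn; apply/eqP; apply: contraNT not_Nn => fn.
exact: (subsetP supf).
Qed.

(** For v outside W the cosets W f(v), f in End(N), are distinct: the difference
    of two distinct endomorphisms is injective by minimality of N and maps W
    into, hence onto, W; it cannot map v into W. *)
Lemma leq_card_End_index Z y : 1 \in bad G N Z y -> forall W : {group gT},
  W :=: bad G N Z y -> W \proper N -> #|conj_End G N| <= #|N : W|.
Proof.
move=> bad1 W defW /properP[sWN [v Nv not_Wv]].
pose h (f : {ffun gT -> gT}) := W :* f v.
have injh: {in conj_End G N &, injective h}.
  move=> f f' /conj_EndP[Nf fM fJ f0] /conj_EndP[Nf' fM' fJ' f0'] eq_h.
  have cNN := centsP abelN.
  pose g n := f n * (f' n)^-1.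
  have Ng: {in N, forall n, g n \in N} by move=> n Nn; rewrite groupM ?groupV ?Nf ?Nf'.
  have gM: {in N &, {morph g : n n' / n * n'}}.
    move=> n n' Nn Nn'; rewrite /g fM // fM' // invMg -!mulgA; congr (_ * _).
    by rewrite [RHS]cNN ?groupM ?groupV ?Nf ?Nf' // -!mulgA.
  have gJ: {in N & G, forall n x, g (n ^ x) = g n ^ x}.
    by move=> n x Nn Gx; rewrite /g fJ // fJ' // conjMg conjVg.
  have Wgv: g v \in W by rewrite -mem_rcoset -[_ :* _]eq_h rcoset_refl.
  pose k := Morphism gM.
  have nK: G \subset 'N('ker k).
    apply/subsetP=> x Gx; rewrite inE; apply/subsetP=> _ /imsetP[n kn ->].
    have Nn := dom_ker kn; have := mker kn; rewrite /= => gn.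
    apply/kerP; first exact: (memJN minN).
    by rewrite /= gJ // gn conj1g.
  have [kerk | kerk] := minnormal_cases minN (subsetIl N _ : 'ker k \subset N) nK.
    have injk : {in N &, injective k} by apply/injmP; rewrite kerk.
    have gW: k @: W = W.
      apply/eqP; rewrite eqEcard card_in_imset; last first.
        by move=> n n' /(subsetP sWN) Nn /(subsetP sWN) Nn'; apply: injk.
      rewrite leqnn andbT; apply/subsetP=> _ /imsetP[n Wn ->].
      by rewrite defW (bad_endo minN sNG (f := g)) // -defW.
    have: g v \in k @: W by rewrite gW.
    case/imsetP=> w Ww /injk eq_vw; case/negP: not_Wv.
    by rewrite eq_vw // (subsetP sWN).
  apply/ffunP=> n; have [Nn | not_Nn] := boolP (n \in N).
    have /mker /= : n \in 'ker k by rewrite kerk.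
    by move/eqP; rewrite /g -eq_mulgV1 => /eqP.
  by rewrite f0 ?f0' ?inE.
rewrite -(card_in_imset injh) subset_leq_card //; apply/subsetP=> _ /imsetP[f Ef ->].
by have [Nf _ _ _] := conj_EndP Ef; apply/rcosetsP; exists (f v); rewrite ?Nf.
Qed.

End Endo.

Section One.

Variables (gT : finGroupType) (G : {group gT}).
Hypothesis solG : solvable G.
Variables (X1 X2 : {set gT}).
Hypotheses (sX1G : X1 \subset G) (sX2G : X2 \subset G).
Hypotheses (nb1 : has_neighbour G 1 X1) (nb2 : has_neighbour G 1 X2).
Hypothesis modN : forall N : {group gT}, minnormal N G -> N \subset G ->
  common_neighbour_mod G 1 N X1 X2.
Hypothesis endN : forall N : {group gT}, minnormal N G -> N \subset G ->
  [splits G, over N] -> ~~ (N \subset 'C(G)) -> 2 < #|conj_End G N|.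

Lemma entries1 (Y : 'I_1 -> gT) : entries Y = [set Y ord0].
Proof.
by rewrite -entries_const; apply: eq_imset => i; rewrite [i]ord1.
Qed.

(** In a stuck situation N would be the union of the corrections that are bad for
    X1 and of those bad for X2, each at most a third of N. *)
Lemma common_neighbour1 : common_neighbour_mod G 1 1 X1 X2 .
Proof.
have [] := boolP [exists y in G, (<<y |: X1>> == G) && (<<y |: X2>> == G)].
  case/exists_inP=> y Gy /andP[/eqP gen1 /eqP gen2]; exists (fun=> y).
  by rewrite entries_const !mul1g ![_ :|: [set y]]setUC sub1set.
move=> no_y; have stuck: ~ common_neighbour_mod G 1 1 X1 X2.
  case=> Y []; rewrite !mul1g entries1 ![_ :|: [set _]]setUC sub1set => GY gen1 gen2.
  by case/exists_inP: no_y; exists (Y ord0); rewrite ?gen1 ?gen2 ?eqxx.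
have complG := mincex_compl solG sX1G sX2G nb2 modN stuck.
have nnil := mincex_nonnilpotent solG sX1G sX2G nb1 nb2 modN stuck.
have [E [S [nsEG abE ntE tiEC _]]] := nonnilpotent_split solG complG nnil.
have [N minN sNE] := minnormal_exists ntE (normal_norm nsEG).
have sNG := subset_trans sNE (normal_sub nsEG).
have abelN := abelianS sNE abE.
have ntN := minnormal_neq1 minN.
have big_End: 2 < #|conj_End G N|.
  apply: endN => //.
    by have [M cM] := complG N minN sNG; apply/splitsP; exists M.
  by apply: contra ntN => cN; rewrite -subG1 -tiEC subsetI sNE.
have [Y []] := modN minN sNG; set y := Y ord0.
rewrite !entries1 ![_ :|: [set _]]setUC sub1set -/y => Gy gen1 gen2.
have leX (X : {set gT}) : X \subset G -> has_neighbour G 1 X -> N * <<y |: X>> = G ->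
    #|bad G N X y| * 3 <= #|N|.
  move=> sXG [Y0 []]; rewrite entries1 sub1set setUC => GY0 gen0 gen.
  apply: (card_bad minN) => //.
    have [n Nn good] := gaschutz1 minN sNG abelN sXG GY0 gen0 Gy gen.
    apply/eqP=> eqN; move: Nn (Nn); rewrite -{1}eqN => badn Nn.
    by move: badn; rewrite (bad_gen minN sNG abelN) // good eqxx.
  move=> n badn W defW pW; apply: leq_trans big_End _.
  have Nn := subsetP (bad_sub G N X y) n badn.
  apply: (leq_card_End_index minN sNG abelN _ defW pW).
  by rewrite -bad_shift ?mulg1.
have sNbad: N \subset bad G N X1 y :|: bad G N X2 y.
  apply/subsetP=> n Nn; rewrite inE !(bad_gen minN sNG abelN) // -negb_and.
  apply: contra no_y => /andP[g1 g2]; apply/exists_inP; exists (y * n).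
    by rewrite groupM // (subsetP sNG).
  by rewrite g1.
have /leq_trans := subset_leq_card sNbad.
move/(_ _ (leq_card_setU _ _)).
have := leX X1 sX1G nb1 gen1; have := leX X2 sX2G nb2 gen2.
have := cardG_gt0 N; move: #|bad _ _ X1 _| #|bad _ _ X2 _| #|N| => c1 c2 m.
move=> m0 h2 h1 h; have: (c1 + c2) * 3 <= m + m by rewrite mulnDl leq_add.
move=> h3; have: m * 3 <= m + m by apply: leq_trans h3; rewrite leq_mul2r h.
by rewrite addnn -muln2 leq_pmul2l.
Qed.

End One.

(** * Walks whose middle edge cannot be repaired *)

Section Base.

Variables (gT : finGroupType) (G : {group gT}).
Implicit Types (D E K M N P S : {group gT}).

(** A walk x, y1, y2, x' whose middle edge exists only modulo N, and which no
    correction of y1 and y2 along N turns into a walk of the graph. *)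
Definition broken_walk (x y1 y2 x' : gT) (N : {set gT}) :=
  [/\ [/\ x \in G, y1 \in G, y2 \in G & x' \in G],
      <<[set y1; x]>> = G, <<[set y2; x']>> = G, N * <<[set y1; y2]>> = G
    & forall n1 n2, n1 \in N -> n2 \in N ->
        <<[set y1 * n1; x]>> = G -> <<[set y2 * n2; x']>> = G ->
        <<[set y1 * n1; y2 * n2]>> <> G].

Lemma broken_walk_sym x y1 y2 x' N :
  broken_walk x y1 y2 x' N -> broken_walk x' y2 y1 x N.
Proof.
case=> [[Gx Gy1 Gy2 Gx'] gx gx' gy fail]; split=> //; first by rewrite setUC.
by move=> n2 n1 Nn2 Nn1 g2 g1; rewrite setUC; apply: fail.
Qed.

Variable N : {group gT}.
Hypotheses (minN : minnormal N G) (sNG : N \subset G) (abelN : abelian N).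

Section Facts.

Variables x y1 y2 x' : gT.
Hypothesis brk : broken_walk x y1 y2 x' N.

Let Gx : x \in G. Proof. by case: brk => [[]]. Qed.
Let Gy1 : y1 \in G. Proof. by case: brk => [[]]. Qed.
Let Gy2 : y2 \in G. Proof. by case: brk => [[]]. Qed.
Let Gx' : x' \in G. Proof. by case: brk => [[]]. Qed.
Let gx : <<[set y1; x]>> = G. Proof. by case: brk. Qed.
Let gx' : <<[set y2; x']>> = G. Proof. by case: brk. Qed.
Let gy : N * <<[set y1; y2]>> = G. Proof. by case: brk. Qed.
Let fail n1 n2 : n1 \in N -> n2 \in N ->
        <<[set y1 * n1; x]>> = G -> <<[set y2 * n2; x']>> = G ->
        <<[set y1 * n1; y2 * n2]>> <> G.
Proof. by case: brk => _ _ _ _; apply. Qed.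

Let badx_gen n : n \in N -> (n \in bad G N [set x] y1) = (<<[set y1 * n; x]>> != G).
Proof.
by move=> Nn; rewrite (bad_gen minN sNG abelN) ?sub1set // gx mulSGid.
Qed.

Let bady_gen n : n \in N -> (n \in bad G N [set y2] y1) = (<<[set y1 * n; y2]>> != G).
Proof. by move=> Nn; rewrite (bad_gen minN sNG abelN) ?sub1set. Qed.

Lemma bad_x_prop : bad G N [set x] y1 != N.
Proof.
apply/eqP=> /setP/(_ 1); rewrite group1 badx_gen ?group1 //.
by rewrite mulg1 gx eqxx.
Qed.

Lemma bad_y_prop : bad G N [set y2] y1 != N.
Proof.
apply/eqP=> eqN; have sy2G : [set y2] \subset G by rewrite sub1set.
have gx'0 : <<x' |: [set y2]>> = G by rewrite setUC.
have [n Nn good] := gaschutz1 minN sNG abelN sy2G Gx' gx'0 Gy1 gy.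
by move/setP/(_ n): eqN; rewrite Nn bady_gen // good eqxx.
Qed.

Lemma bad_y_group : group_set (bad G N [set y2] y1).
Proof.
apply: (bad_group minN sNG abelN); rewrite bady_gen ?group1 // mulg1.
apply/eqP=> eqG; have := @fail 1 1 (group1 N) (group1 N).
by rewrite !mulg1; apply.
Qed.

(** A correction of y1 that is good for both x and y2 would repair the walk. *)
Lemma bad_cover : bad G N [set x] y1 :|: bad G N [set y2] y1 = N.
Proof.
apply/eqP; rewrite eqEsubset subUset !bad_sub; apply/subsetP=> n Nn; rewrite inE.
rewrite badx_gen // bady_gen // -negb_and; apply/negP=> /andP[/eqP g1 /eqP g2].
by have := fail Nn (group1 N); rewrite mulg1; apply.
Qed.

(** Two translates of proper subgroups cover N only if they are disjoint and
    each is half of N. *)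
Lemma card_bad_x : (#|bad G N [set x] y1| * 2)%N = #|N| /\
   [disjoint bad G N [set x] y1 & bad G N [set y2] y1].
Proof.
have le1 := card_bad2 minN sNG abelN bad_x_prop.
have le2 := card_bad2 minN sNG abelN bad_y_prop.
have := cardsUI (bad G N [set x] y1) (bad G N [set y2] y1).
rewrite -setI_eq0 -cards_eq0 bad_cover.
set a := #|bad G N [set x] y1| in le1 *; set c := #|bad G N [set y2] y1| in le2 *.
by move=> eqm; split; [| apply/eqP]; lia.
Qed.

Definition good (z y : gT) := [set n in N | <<[set y * n; z]>> == G].

(** In particular the corrections of y1 that keep the edge to x form a subgroup
    of index 2 in N. *)
Lemma goodE : good x y1 = bad G N [set y2] y1.
Proof.
have [_ dis] := card_bad_x; apply/setP=> n; rewrite inE.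
have [Nn | not_Nn] := boolP (n \in N); last first.
  by apply/esym/negbTE; apply: contra not_Nn; apply/subsetP/bad_sub.
rewrite -[_ == _]negbK -badx_gen //; have := Nn; rewrite -{1}bad_cover inE.
by case: (boolP (n \in bad G N [set x] y1)) => [/(disjointFr dis)-> | _ /= ->].
Qed.

End Facts.

Lemma index2_quot (C : {group gT}) a n : C \subset N -> (#|C| * 2)%N = #|N| ->
  a \in N -> n \in N -> a \notin C -> n \notin C -> a^-1 * n \in C.
Proof.
move=> sCN cardC Na Nn Ca Cn.
have sUN: C :|: a *: C \subset N.
  by rewrite subUset sCN -(lcoset_id Na) mulgS.
have eqU: C :|: a *: C = N.
  apply/eqP; rewrite eqEcard sUN /= cardsU card_lcoset.
  suffices ->: C :&: a *: C = set0 by  rewrite cards0 -cardC subn0 muln2 addnn.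
  apply/setP=> c; rewrite !inE mem_lcoset; apply/negP=> /andP[Cc Cac].
  by case/negP: Ca; rewrite -groupV -(groupMr _ Cc).
by move: Nn; rewrite -{1}eqU inE (negPf Cn) mem_lcoset.
Qed.

Section Facts2.

Variables x y1 y2 x' : gT.
Hypothesis brk : broken_walk x y1 y2 x' N.

Lemma good_group : group_set (good x y1).
Proof. by rewrite (goodE brk); apply: bad_y_group brk. Qed.

Lemma good_sub : good x y1 \subset N.
Proof. by apply/subsetP=> n; rewrite inE => /andP[]. Qed.

Lemma card_good : (#|good x y1| * 2)%N = #|N|.
Proof.
have [card2 dis] := card_bad_x brk; have := bad_cover brk.
move/(congr1 (fun A : {set gT} => #|A|)).
rewrite cardsU (eqP (_ : _ :&: _ == set0)) ?setI_eq0 // cards0 -(goodE brk).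
rewrite subn0 -{1}card2 muln2 -addnn => /addnI->; exact: card2.
Qed.

Lemma broken_compl n1 n2 : n1 \in N -> n2 \in N ->
    <<[set y1 * n1; y2 * n2]>> <> G ->
  exists M, [/\ M \in [complements to N in G], y1 * n1 \in M & y2 * n2 \in M].
Proof.
have [[Gx Gy1 Gy2 Gx'] gx gx' gy fail] := brk => Nn1 Nn2 neqG.
have Gyn1 : y1 * n1 \in G by rewrite groupM // (subsetP sNG).
have Gyn2 : y2 * n2 \in G by rewrite groupM // (subsetP sNG).
have gyn : N * <<[set y1 * n1; y2 * n2]>> = G.
  apply: (gen_mulN1 minN sNG) => //; rewrite ?sub1set //.
  rewrite setUC; apply: (gen_mulN1 minN sNG) => //; rewrite ?sub1set //.
  by rewrite setUC.
have sG: [set y1 * n1; y2 * n2] \subset G by rewrite subUset !sub1set Gyn1.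
have [//|cM] := gen_supplement minN abelN sG gyn; set Z := [set _; _] in cM.
by exists <<Z>>%G; rewrite cM !mem_gen // !inE eqxx ?orbT.
Qed.

Lemma compl_broken M n1 n2 : M \in [complements to N in G] ->
  y1 * n1 \in M -> y2 * n2 \in M -> <<[set y1 * n1; y2 * n2]>> <> G.
Proof.
move=> cM My1 My2 eqG; have sGM: G \subset M.
  by rewrite -eqG gen_subG subUset !sub1set My1.
have /complP[tiM _] := cM; case/negP: (minnormal_neq1 minN).
by rewrite -subG1 -tiM subsetI subxx (subset_trans sNG).
Qed.

Lemma broken_base : exists M,
  [/\ M \in [complements to N in G], y1 \in M & y2 \in M].
Proof.
have [[Gx Gy1 Gy2 Gx'] gx gx' gy fail] := brk.
have := broken_compl (group1 N) (group1 N); rewrite !mulg1; apply.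
by have := fail 1 1 (group1 N) (group1 N); rewrite !mulg1; apply.
Qed.

(** Divide a complement over y1 n1 and y2 n2 by one over y1 n1 and y2: the result
    contains y1 and y2 n2. *)
Lemma good_imp n1 n2 : n1 \in N -> n2 \in N ->
    <<[set y1 * n1; y2 * n2]>> <> G -> n1 \in good x y1 -> n2 \in good x' y2.
Proof.
move=> Nn1 Nn2 neqG; rewrite (goodE brk) (goodE (broken_walk_sym brk)).
have [M [cM My1 My2]] := broken_compl Nn1 Nn2 neqG.
have [M0 [cM0 M0y1 M0y2]] := broken_base.
case/badP=> _ [M1 [cM1]]; rewrite sub1set => M1y2 M1y1.
have [M2 cM2 defM2] := cofactor_quotient minN sNG abelN cM0 cM cM1.
apply/badP; split=> //; exists M2; split=> //.
  by rewrite sub1set -[y1]mulg1 -(mulgV n1) defM2.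
by rewrite -[n2]mulg1 -invg1 defM2 ?mulg1 ?group1.
Qed.

End Facts2.

Section Facts3.

Variables x y1 y2 x' : gT.
Hypothesis brk : broken_walk x y1 y2 x' N.
Let brk' := broken_walk_sym brk.

Lemma good_iff n1 n2 : n1 \in N -> n2 \in N ->
    <<[set y1 * n1; y2 * n2]>> <> G -> (n1 \in good x y1) = (n2 \in good x' y2).
Proof.
move=> Nn1 Nn2 neqG; apply/idP/idP; first exact: (good_imp brk).
by apply: (good_imp brk') => //; rewrite setUC.
Qed.

(** The pairs with both entries good are clear.  A complement over x gives one pair
    with both entries bad, and all others differ from it by good pairs. *)
Lemma good_pair_compl n1 n2 : n1 \in N -> n2 \in N ->
    (n1 \in good x y1) = (n2 \in good x' y2) ->
  exists M, [/\ M \in [complements to N in G], y1 * n1 \in M & y2 * n2 \in M].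
Proof.
have [[Gx Gy1 Gy2 Gx'] gx gx' gy fail] := brk => Nn1 Nn2.
have goodM c1 c2 : c1 \in good x y1 -> c2 \in good x' y2 ->
   exists M, [/\ M \in [complements to N in G], y1 * c1 \in M & y2 * c2 \in M].
  rewrite !inE => /andP[Nc1 /eqP g1] /andP[Nc2 /eqP g2].
  by apply: (broken_compl brk) => //; apply: fail.
have [good1 /esym good2 | bad1 /esym bad2] := boolP (n1 \in good x y1).
  exact: goodM.
have [a1 bada1]: exists a1, a1 \in bad G N [set x] y1.
  apply/set0Pn; rewrite -cards_eq0; apply/eqP=> card0.
  by have [] := card_bad_x brk; rewrite card0 => /esym/eqP; rewrite eqn0Ngt cardG_gt0.
have not_good1: a1 \notin good x y1.
  by rewrite (goodE brk) (disjointFr _ bada1) //; case: (card_bad_x brk).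
have [Na1 [Mx [cMx sxMx Mxy1]]] := badP _ _ _ _ _ bada1.
have Na2 := mem_cofactor minN cMx Gy2; have Mxy2 := mul_cofactor cMx Gy2.
set a2 := cofactor N Mx y2 in Na2 Mxy2.
have not_good2: a2 \notin good x' y2.
  by rewrite -(good_iff Na1 Na2) //; apply: compl_broken cMx Mxy1 Mxy2.
have gC1: a1^-1 * n1 \in good x y1.
  have := @index2_quot (Group (good_group brk)); apply=> //.
    exact: good_sub.
  exact: card_good brk.
have gC2: a2^-1 * n2 \in good x' y2.
  have := @index2_quot (Group (good_group brk')); apply=> //.
  - exact: good_sub.
  - exact: card_good brk'.
  by rewrite /= bad2.
have [M0 [cM0 M0y1 M0y2]] := broken_base brk.
have [||M [cM My1 My2]] := goodM (a1^-1 * n1)^-1 (a2^-1 * n2)^-1.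
- by have := groupVr (G := Group (good_group brk)) gC1.
- by have := groupVr (G := Group (good_group brk')) gC2.
have [M2 cM2 defM2] := cofactor_quotient minN sNG abelN cM0 cMx cM.
exists M2; split=> //.
  rewrite -[n1](mulKVg a1) -[a1^-1 * n1]invgK defM2 ?groupV //.
  by rewrite groupM ?groupV.
rewrite -[n2](mulKVg a2) -[a2^-1 * n2]invgK defM2 ?groupV //.
by rewrite groupM ?groupV.
Qed.

Lemma card_compl_broken : #|N| * #|N| <= #|[complements to N in G]| * 2.
Proof.
have [[Gx Gy1 Gy2 Gx'] _ _ _ _] := brk.
pose P := [set u : gT * gT | [&& u.1 \in N, u.2 \in N &
             (u.1 \in good x y1) == (u.2 \in good x' y2)]].
have cardP: (#|P| * 2)%N = (#|N| * #|N|)%N.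
  have ->: P = setX (good x y1) (good x' y2)
            :|: setX (N :\: good x y1) (N :\: good x' y2).
    apply/setP=> [[n1 n2]]; rewrite !inE /=.
    case: (n1 \in N); case: (n2 \in N); rewrite ?andbF ?andFb //=.
    by rewrite !andbT; case: (<<[set y1 * n1; x]>> == G); case: (<<_>> == G).
  rewrite cardsU (_ : _ :&: _ = set0) ?cards0 ?subn0 ?cardsX; last first.
    by apply/setP=> [[n1 n2]]; rewrite !inE /=; case: (n1 \in N);
      case: (<<[set y1 * n1; x]>> == G); rewrite ?andbF.
  have cardD z y : (#|good z y| * 2)%N = #|N| -> #|N :\: good z y| = #|good z y|.
    move=> cd; rewrite cardsD (setIidPr (good_sub z y)) -cd muln2 -addnn.
    by rewrite addnK.
  rewrite !cardD ?(card_good brk) ?(card_good brk') //.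
  transitivity ((#|good x y1| * 2) * (#|good x' y2| * 2))%N.
    by rewrite mulnACA addnn -muln2 mulnA.
  by rewrite (card_good brk) (card_good brk').
rewrite -cardP leq_mul2r; apply/orP; right.
pose f M := (cofactor N M y1, cofactor N M y2).
apply: leq_trans (leq_imset_card f _); apply/subset_leq_card/subsetP=> -[n1 n2].
rewrite inE /= => /and3P[Nn1 Nn2 /eqP eqg].
have [M [cM My1 My2]] := good_pair_compl Nn1 Nn2 eqg.
apply/imsetP; exists M => //; congr (_, _).
  exact: (cofactor_uniq cM Nn1 (mem_cofactor minN cM Gy1) My1 (mul_cofactor cM Gy1)).
exact: (cofactor_uniq cM Nn2 (mem_cofactor minN cM Gy2) My2 (mul_cofactor cM Gy2)).
Qed.

End Facts3.

Section InAbelian.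

Variables (E : {group gT}).
Hypotheses (nsEG : E <| G) (abE : abelian E) (sNE : N \subset E).

Section Facts4.

Variables x y1 y2 x' : gT.
Hypothesis brk : broken_walk x y1 y2 x' N.
Variable S : {group gT}.
Hypotheses (sSG : S \subset G) (defG : E * S = G) (tiES : E :&: S = 1).
Hypotheses (supE : supplements_split G E S) (Sx : x \in S).

(** By counting: N has at least |N|^2 / 2 complements in G, hence at least |N| / 2
    normal complements D in E, and each D <*> S contains x.  But only |N| / 2
    complements of N contain x, one for each bad correction of y1. *)
Lemma broken_compl_over M : M \in [complements to N in G] -> x \in M ->
  exists2 D, D \in normal_compl G E N & M :=: D <*> S.
Proof.
have [[Gx Gy1 Gy2 Gx'] gx _ _ _] := brk; move=> cM Mx.
pose Cx := [set M : {group gT} | (M \in [complements to N in G]) && (x \in M)].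
pose h (D : {group gT}) := (D <*> S)%G.
have Cxh: h @: normal_compl G E N \subset Cx.
  apply/subsetP=> _ /imsetP[D ED ->]; rewrite inE (normal_compl_join sSG defG tiES sNE ED) /=.
  by rewrite (subsetP (joing_subr _ _)).
have injh: {in normal_compl G E N &, injective h}.
  have EhD D : D \in normal_compl G E N -> E :&: h D = D.
    case/normal_complP=> /andP[sDG nDG] defE _.
    have sDE: D \subset E by rewrite -defE mulG_subr.
    rewrite /= norm_joinEr ?(subset_trans sSG) // setIC -group_modl //.
    by rewrite [S :&: E]setIC tiES mulg1.
  move=> D1 D2 ED1 ED2 eq_h; apply: group_inj.
  by rewrite -(EhD D1) // eq_h EhD.
have cardCx: (#|Cx| * 2)%N <= #|N|.
  have [<- _] := card_bad_x brk; rewrite leq_mul2r /=.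
  pose f M := cofactor N M y1.
  have injf: {in Cx &, injective f}.
    move=> M1 M2 /setIdP[cM1 M1x] /setIdP[cM2 M2x] eq_f.
    have gen M0 : M0 \in [complements to N in G] -> x \in M0 ->
        <<[set y1 * f M0; x]>> = M0.
      move=> cM0 M0x; apply: (gen_compl minN abelN cM0).
        by rewrite subUset !sub1set M0x (mul_cofactor cM0 Gy1).
      apply: (gen_mulN1 minN sNG); rewrite ?sub1set ?(mem_cofactor minN cM0 Gy1) //.
      by rewrite gx mulSGid.
    by apply: group_inj; rewrite -(gen M1 cM1 M1x) eq_f gen.
  rewrite -(card_in_imset injf) subset_leq_card //.
  apply/subsetP=> _ /imsetP[M0 /setIdP[cM0 M0x] ->].
  apply/badP; rewrite (mem_cofactor minN cM0 Gy1) //; split=> //.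
  by exists M0; rewrite sub1set (mul_cofactor cM0 Gy1).
have eqCx: h @: normal_compl G E N = Cx.
  apply/eqP; rewrite eqEcard Cxh (card_in_imset injh).
  have le1 := card_compl_broken brk.
  have le2 := leq_card_compl nsEG abE sSG minN sNE supE.
  have N0 := cardG_gt0 N.
  have : #|N| * #|N| <= #|normal_compl G E N| * 2 * #|N|.
    by rewrite (leq_trans le1) // mulnAC leq_mul2r le2 orbT.
  rewrite leq_pmul2r // => le3.
  by rewrite -(leq_pmul2r (isT : 0 < 2)) (leq_trans cardCx).
have: M \in Cx by rewrite inE cM.
by rewrite -eqCx => /imsetP[D ED ->]; exists D.
Qed.

End Facts4.

End InAbelian.

End Base.

(** * Equivariant homomorphisms *)

Section EquivHom.

Variables (gT : finGroupType) (G : {group gT}).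
Implicit Types (D E K M N P S Z : {group gT}) (f : gT -> gT).

(** Homomorphisms E -> N that commute with conjugation by G, kept as plain
    functions so that they can be multiplied, composed and restricted freely. *)
Definition equiv_hom (E N : {set gT}) f :=
  [/\ {in E, forall z, f z \in N}, {in E &, {morph f : z w / z * w}}
    & {in E & G, forall z x, f (z ^ x) = f z ^ x}].

Lemma equiv_hom1 E N f : equiv_hom E N f -> f 1 = 1.
Proof.
case=> _ fM _; have := fM 1 1 (group1 _) (group1 _); rewrite mulg1 => /eqP.
by rewrite eq_mulVg1 mulKg => /eqP.
Qed.

Lemma equiv_homV E N f z : equiv_hom E N f -> z \in E -> f z^-1 = (f z)^-1.
Proof.
move=> ehf Ez; have [_ fM _] := ehf; apply/eqP; rewrite eq_sym eq_invg_mul.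
by rewrite -fM ?groupV // mulgV (equiv_hom1 ehf).
Qed.

Lemma equiv_hom_div E N f (g : gT -> gT) : abelian N ->
  equiv_hom E N f -> equiv_hom E N g -> equiv_hom E N (fun z => f z * (g z)^-1).
Proof.
move=> abN [Nf fM fJ] [Ng gM gJ]; split.
- by move=> z Ez; rewrite groupM ?groupV ?Nf ?Ng.
- move=> z w Ez Ew /=; rewrite fM // gM // invMg -!mulgA; congr (_ * _).
  by rewrite [RHS](centsP abN) ?groupM ?groupV ?Nf ?Ng // -!mulgA.
by move=> z x Ez Gx /=; rewrite fJ // gJ // conjMg conjVg.
Qed.

Lemma equiv_hom_comp E N P f g :
  equiv_hom E N f -> equiv_hom N P g -> equiv_hom E P (g \o f).
Proof.
move=> [Nf fM fJ] [Ng gM gJ]; split=> /=.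
- by move=> z Ez; rewrite Ng ?Nf.
- by move=> z w Ez Ew /=; rewrite fM // gM ?Nf.
by move=> z x Ez Gx /=; rewrite fJ // gJ ?Nf.
Qed.

Lemma equiv_hom_sub E N P f : P \subset E -> equiv_hom E N f -> equiv_hom P N f.
Proof.
move=> /subsetP sPE [Nf fM fJ]; split.
- by move=> z /sPE; apply: Nf.
- by move=> z w /sPE Ez /sPE Ew; apply: fM.
by move=> z g /sPE Ez; apply: fJ.
Qed.

Lemma equiv_hom_commg N P f k v : N <| G -> equiv_hom N P f ->
  k \in G -> v \in N -> f [~ k, v] = [~ k, f v].
Proof.
move=> /andP[_ nNG] ehf Gk Nv; have [_ fM fJ] := ehf.
rewrite !commgEr fM ?fJ ?groupV //; first by rewrite (equiv_homV ehf).
by rewrite memJ_norm ?groupV // (subsetP nNG).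
Qed.

Lemma equiv_hom_ker E N f : E <| G -> equiv_hom E N f ->
  exists K : {group gT}, K <| G /\ K :=: [set z in E | f z == 1].
Proof.
move=> /andP[sEG nEG] ehf; have [Nf fM fJ] := ehf.
have gK: group_set [set z in E | f z == 1].
  apply/group_setP; split; first by rewrite inE group1 (equiv_hom1 ehf) eqxx.
  move=> z w; rewrite !inE => /andP[Ez /eqP fz] /andP[Ew /eqP fw].
  by rewrite groupM // fM // fz fw mulg1 eqxx.
exists (Group gK); split=> //; apply/andP; split=> /=.
  by apply: subset_trans sEG; apply/subsetP=> z; rewrite inE => /andP[].
apply/subsetP=> g Gg; rewrite inE; apply/subsetP=> _ /imsetP[z + ->].
rewrite !inE => /andP[Ez /eqP fz]; rewrite memJ_norm ?(subsetP nEG) // Ez /=.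
by rewrite fJ // fz conj1g.
Qed.

Lemma equiv_hom_proj E N D : E <| G -> abelian E -> N <| G -> N \subset E ->
    D \in normal_compl G E N ->
  [/\ equiv_hom E N (remgr D N), {in N, forall n, remgr D N n = n}
    & {in E, forall z, (remgr D N z == 1) = (z \in D)}].
Proof.
move=> /andP[sEG nEG] abE /andP[sNG nNG] sNE.
case/normal_complP=> /andP[sDG nDG] defE tiND.
have sDE: D \subset E by rewrite -defE mulG_subr.
have defDN: D * N = E.
  by rewrite -defE; apply: centC; apply: sub_abelian_cent2 abE _ _.
have tiDN: D :&: N = 1 by rewrite setIC.
have compN: N \in [complements to D in E] by apply/complP.
have splitE z : z \in E -> exists d n, [/\ d \in D, n \in N & z = d * n].
  by rewrite -defDN => /mulsgP[d n Dd Nn ->]; exists d, n.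
split.
- split.
  + by move=> z Ez; rewrite mem_remgr ?defDN.
  + apply: remgrM => //; rewrite /normal sDE.
    exact: subset_trans (sub_abelian_cent abE sDE) (cent_sub _).
  move=> _ g /splitE[d [n [Dd Nn ->]]] Gg; rewrite conjMg !remgrMid //.
    by rewrite memJ_norm ?(subsetP nDG).
  by rewrite memJ_norm ?(subsetP nNG).
- by move=> n Nn; rewrite -[n in LHS]mul1g remgrMid.
move=> _ /splitE[d [n [Dd Nn ->]]]; rewrite remgrMid // groupMl //.
apply/eqP/idP=> [-> | Dn]; first exact: group1.
by apply/set1P; rewrite -[[set 1]]tiDN inE Dn.
Qed.

Lemma equiv_hom_minnormal Z P f : minnormal Z G -> Z <| G -> P <| G ->
    equiv_hom Z P f -> {in Z &, injective f} ->
  exists Zf : {group gT}, [/\ minnormal Zf G, Zf \subset P & Zf :=: f @: Z].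
Proof.
move=> minZ nsZG /andP[sPG nPG] ehf injf; have [Pf fM fJ] := ehf.
have [sZG nZG] := andP nsZG.
pose k := Morphism fM.
have defkZ (A : {set gT}) : A \subset Z -> k @* A = f @: A.
  by move=> sAZ; rewrite morphimEsub.
exists (k @* Z)%G; split; last exact: defkZ.
  apply/mingroupP; split=> [|K /andP[ntK nKG] sKfZ].
    rewrite -cardG_gt1 card_injm ?cardG_gt1 ?(minnormal_neq1 minZ) //; last first.
      exact/injmP.
    apply/subsetP=> g Gg; rewrite inE /= defkZ //; apply/subsetP=> _ /imsetP[_ /imsetP[z Zz ->] ->].
    by rewrite -fJ //; apply: imset_f; rewrite memJ_norm ?(subsetP nZG).
  have nK'G: G \subset 'N(k @*^-1 K).
    apply/subsetP=> g Gg; rewrite inE; apply/subsetP=> _ /imsetP[z + ->].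
    rewrite !inE => /andP[Zz Kfz]; rewrite memJ_norm ?(subsetP nZG) // Zz /=.
    by rewrite fJ // memJ_norm // (subsetP nKG).
  have [K'1 | K'Z] := minnormal_cases minZ (subsetIl Z _ : k @*^-1 K \subset Z) nK'G.
    case/negP: ntK; rewrite -(morphpreK sKfZ) /= K'1 morphim1 //.
  by apply/eqP; rewrite eqEsubset sKfZ /= sub_morphim_pre // K'Z.
by rewrite /= defkZ //; apply/subsetP=> _ /imsetP[z Zz ->]; apply: Pf.
Qed.

End EquivHom.

(** * Evaluating equivariant homomorphisms at a broken walk *)

Lemma commg_mulE (gT : finGroupType) (E : {group gT}) (k u w : gT) :
  abelian E -> u \in E -> w \in E -> (w^-1) ^ k \in E -> [~ k * u, w] = [~ k, w].
Proof.
move=> abE Eu Ew Ewk; rewrite !commgEr conjgM; congr (_ * _).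
by apply/conjg_fixP/commgP; apply: (centsP abE).
Qed.

Section Structure.

Variables (gT : finGroupType) (G E : {group gT}).
Hypotheses (nsEG : E <| G) (abE : abelian E).
Implicit Types (D K M N P S Z L : {group gT}) (f : gT -> gT).

Let sEG : E \subset G := normal_sub nsEG.
Let nEG : G \subset 'N(E) := normal_norm nsEG.

Section OneSide.

Variables (S : {group gT}) (x y1 k u : gT).
Hypotheses (sSG : S \subset G) (defG : E * S = G) (tiES : E :&: S = 1).
Hypotheses (supE : supplements_split G E S) (Sx : x \in S).
Hypotheses (Sk : k \in S) (Eu : u \in E) (def_y1 : y1 = k * u).
Hypothesis gx : <<[set y1; x]>> = G.

(** The kernel K of f is normal in G and K S contains y1 and x, so K S = G. *)
Lemma equiv_hom_gen_trivial P f :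
  equiv_hom G E P f -> f u = 1 -> {in E, forall z, f z = 1}.
Proof.
move=> ehf fu1; have [K [/andP[sKG nKG] defK]] := equiv_hom_ker nsEG ehf.
have Ku: u \in K by rewrite defK inE Eu fu1 /=.
have sGK: G \subset K <*> S.
  rewrite -gx gen_subG subUset !sub1set def_y1 groupM /=.
  - by rewrite (subsetP (joing_subr K S)).
  - by rewrite (subsetP (joing_subr K S)).
  by rewrite (subsetP (joing_subl K S)).
move=> z Ez; have: z \in K <*> S by rewrite (subsetP sGK) ?(subsetP sEG).
rewrite norm_joinEr ?(subset_trans sSG) // => /mulsgP[c s Kc Ss def_z].
have Ec: c \in E by move: Kc; rewrite defK inE => /andP[].
have s1: s = 1.
  by apply/set1P; rewrite -[[set 1]]tiES inE Ss andbT -(groupMl _ Ec) -def_z.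
by move: Kc; rewrite defK inE def_z s1 mulg1 => /andP[_ /eqP].
Qed.

Lemma equiv_hom_gen_eq P f (g : gT -> gT) : abelian P ->
    equiv_hom G E P f -> equiv_hom G E P g -> f u = g u ->
  {in E, forall z, f z = g z}.
Proof.
move=> abP ehf ehg eq_u z Ez.
have := equiv_hom_gen_trivial (equiv_hom_div abP ehf ehg) _ Ez.
by rewrite eq_u mulgV => /(_ erefl)/eqP; rewrite -eq_mulgV1 => /eqP.
Qed.

Variables (N : {group gT}) (y2 x' : gT).
Hypotheses (minN : minnormal N G) (sNE : N \subset E).
Hypothesis brk : broken_walk G x y1 y2 x' N.

Let sNG : N \subset G := subset_trans sNE sEG.
Let abN : abelian N := abelianS sNE abE.
Let nsNG : N <| G. Proof. by rewrite /normal sNG minnormal_norm. Qed.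
Let gC : {group gT} := Group (good_group minN sNG abN brk).

(** For v that is not good, v^-1 is bad and gives a complement D S over y1 v^-1;
    the projection to N along D takes the value v at u.  A good v is the
    quotient of two elements that are not good. *)
Lemma good_hom v : v \in N -> exists f, [/\ equiv_hom G E N f, f u = v
  & {in N, forall n, f n = if v \in good G N x y1 then 1 else n}].
Proof.
have [[Gx Gy1 _ _] _ _ _ _] := brk.
have not_good_hom w : w \in N -> w \notin good G N x y1 ->
    exists f, [/\ equiv_hom G E N f, f u = w & {in N, forall n, f n = n}].
  move=> Nw; have -> : (w \notin good G N x y1) = (w^-1 \notin gC) by rewrite groupV.
  rewrite /= inE groupV Nw /= -(bad_gen minN sNG abN) ?groupV ?sub1set //; last first.
    by rewrite gx mulSGid.
  case/badP=> _ [M [cM]]; rewrite sub1set => Mx My.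
  have [D ED defM] := broken_compl_over minN sNG abN nsEG abE sNE brk sSG defG
    tiES supE Sx cM Mx.
  have [ehf fN fD] := equiv_hom_proj nsEG abE nsNG sNE ED.
  exists (remgr D N); split=> //.
  have Ewv: w^-1 \in E by rewrite groupV (subsetP sNE).
  have [/andP[sDG nDG] defE _] := normal_complP _ _ _ _ ED.
  have sDE: D \subset E by rewrite -defE mulG_subr.
  have Duw: u * w^-1 \in D.
    have: u * w^-1 \in E :&: (D <*> S).
      have DSk: k \in D <*> S by rewrite (subsetP (joing_subr _ _)).
      by rewrite inE groupM //= -(groupMl _ DSk) mulgA -def_y1 /= -defM.
    rewrite norm_joinEr ?(subset_trans sSG) // setIC -group_modl //.
    by rewrite [S :&: E]setIC tiES mulg1.
  have [_ fM _] := ehf.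
  have := fD (u * w^-1) (groupM Eu Ewv); rewrite Duw.
  by rewrite fM // (fN w^-1) ?groupV // -eq_mulgV1 => /eqP.
move=> Nv; have [gv | /not_good_hom] := boolP (v \in good G N x y1); last exact.
have [w Nw not_gw]: exists2 w, w \in N & w \notin good G N x y1.
  apply/subsetPn; apply/negP=> /subset_leq_card.
  have := card_good minN sNG abN brk; have := cardG_gt0 N.
  by move: #|_| #|_| => m n; lia.
have not_gwv : w * v \notin gC by rewrite groupMr.
have [f [ehf fu fN]] := not_good_hom _ (groupM Nw Nv) not_gwv.
have [f' [ehf' fu' fN']] := not_good_hom _ Nw not_gw.
exists (fun z => f z * (f' z)^-1); split; first exact: equiv_hom_div.
  by rewrite fu fu' (centsP abN w _ v) // mulgK.
by move=> n Nn /=; rewrite fN // fN' // mulgV.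
Qed.

(** An equivariant homomorphism is determined by its value at u, so it is the
    one found in [good_hom]. *)
Lemma good_homE f : equiv_hom G E N f ->
  {in N, forall n, f n = if f u \in good G N x y1 then 1 else n}.
Proof.
move=> ehf n Nn; have [Nf _ _] := ehf.
have [f' [ehf' fu' fN']] := good_hom (Nf u Eu).
by rewrite (equiv_hom_gen_eq abN ehf ehf') ?fu' ?fN' // (subsetP sNE).
Qed.

End OneSide.

Hypothesis complG : forall N, minnormal N G -> N \subset G ->
  exists M, M \in [complements to N in G].

(** If f is trivial on N, it is injective on some minimal normal Z <= D, which it
    maps onto N.  The diagonal P of all c * f c with c in Z then avoids D, and f
    is still nontrivial on it. *)
Lemma detecting_minnormal N D f z : minnormal N G -> N \subset E ->
    D \in normal_compl G E N -> equiv_hom G E N f -> z \in E -> f z != 1 ->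
  exists (P : {group gT}) (g : gT -> gT) (w : gT), [/\ minnormal P G, P \subset E, P :&: D = 1,
    equiv_hom G N P g /\ {in N &, injective g} & w \in P /\ f w != 1].
Proof.
move=> minN sNE ED ehf Ez fz1.
have sNG := subset_trans sNE sEG; have abN := abelianS sNE abE.
have nNG := minnormal_norm minN; have nsNG: N <| G by apply/andP.
have [nsDG defE tiND] := normal_complP _ _ _ _ ED; have [sDG nDG] := andP nsDG.
have sDE: D \subset E by rewrite -defE mulG_subr.
have [Nf fM fJ] := ehf.
have [/existsP[n /andP[Nn fn]] | /existsPn fN1] :=
    boolP [exists n, (n \in N) && (f n != 1)].
  exists N, id, n; split=> //; split=> //.
  by split.
have {}fN1 n : n \in N -> f n = 1.
  by move=> Nn; have := fN1 n; rewrite Nn negbK => /eqP.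
have [K [nsKG defK]] := equiv_hom_ker nsEG ehf.
have nsDKG: D :&: K <| G by rewrite normalI.
have abD := abelianS sDE abE.
have [Q [nsQG defD tiQ]] := normal_abelian_split complG nsDG abD nsDKG (subsetIl _ _).
have ntQ: Q :!=: 1.
  apply: contraNneq fz1 => Q1; move: Ez; rewrite -defE => /mulsgP[n d Nn Dd ->].
  rewrite fM ?(subsetP sNE n) ?(subsetP sDE d) // fN1 // mul1g.
  by move: Dd; rewrite -defD Q1 mulg1 inE defK inE => /and3P[].
have [Z minZ sZQ] := minnormal_exists ntQ (normal_norm nsQG).
have sZD: Z \subset D by rewrite (subset_trans sZQ) // -defD mulG_subr.
have sZE := subset_trans sZD sDE; have sZG := subset_trans sZE sEG.
have nsZG: Z <| G by rewrite /normal sZG minnormal_norm.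
have nZG := normal_norm nsZG.
have kerZ c : c \in Z -> f c = 1 -> c = 1.
  move=> Zc fc; apply/set1P; rewrite -[[set 1]]tiQ !inE defK inE fc eqxx andbT.
  by rewrite (subsetP sZD) ?(subsetP sZE) ?(subsetP sZQ).
have ehfZ := equiv_hom_sub sZE ehf.
have injfZ: {in Z &, injective f}.
  move=> c d Zc Zd eq_f; apply/eqP; rewrite eq_mulgV1; apply/eqP/kerZ.
    by rewrite groupM ?groupV.
  rewrite fM ?groupV ?(subsetP sZE) // (equiv_homV ehf) ?(subsetP sZE) //.
  by rewrite eq_f mulgV.
have [Zf [minZf sZfN defZf]] := equiv_hom_minnormal minZ nsZG nsNG ehfZ injfZ.
have eqZf: f @: Z = N.
  rewrite -defZf; have [|//] := minnormal_cases minN sZfN (minnormal_norm minZf).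
  by move=> Zf1; case/negP: (minnormal_neq1 minZf); apply/eqP.
pose j c := c * f c.
have fj c : c \in Z -> f (j c) = f c.
  move=> Zc; have Ec := subsetP sZE c Zc; have Nfc := Nf c Ec.
  by rewrite /j fM ?(fN1 (f c)) ?mulg1 // (subsetP sNE (f c) Nfc).
have EZ c : c \in Z -> c \in E by apply: (subsetP sZE).
have EfZ c : c \in Z -> f c \in E by move=> Zc; rewrite (subsetP sNE) ?Nf ?EZ.
have ehj: equiv_hom G Z E j.
  split=> [c Zc | c d Zc Zd | c g Zc Gg]; rewrite /j.
  - exact: groupM (EZ c Zc) (EfZ c Zc).
  - rewrite fM ?EZ // -!mulgA; congr (_ * _); rewrite !mulgA; congr (_ * _).
    exact: (centsP abE d (EZ d Zd) (f c) (EfZ c Zc)).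
  by rewrite fJ ?EZ // conjMg.
have injj: {in Z &, injective j}.
  by move=> c d Zc Zd eq_j; apply: injfZ; rewrite -?(fj c) -?(fj d) ?eq_j.
have [P [minP sPE defP]] := equiv_hom_minnormal minZ nsZG nsEG ehj injj.
(* The inverse of f : Z -> N; the default 1 is never used on N. *)
pose h n := odflt 1 [pick c in Z | f c == n].
have hP n : n \in N -> h n \in Z /\ f (h n) = n.
  rewrite /h; case: pickP => [c /andP[Zc /eqP <-] // | noc].
  rewrite -eqZf => /imsetP[c Zc def_n].
  by have := noc c; rewrite Zc def_n eqxx.
have hf c : c \in Z -> h (f c) = c.
  by move=> Zc; have [Zh fh] := hP _ (Nf c (subsetP sZE c Zc)); apply: injfZ.
have ehh: equiv_hom G N Z h.
  split=> [n Nn | n m Nn Nm | n g Nn Gg]; first by case: (hP n Nn).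
    have [[Zn fn] [Zm fm]] := (hP n Nn, hP m Nm).
    rewrite -{1}fn -{1}fm -fM ?(subsetP sZE) // hf ?groupM //.
  have [Zn fn] := hP n Nn.
  rewrite -{1}fn -fJ ?(subsetP sZE) // hf // memJ_norm ?(subsetP nZG) //.
have ehjP: equiv_hom G Z P j.
  have [_ jM jJ] := ehj; split=> // c Zc; rewrite defP; exact: imset_f.
exists P, (j \o h).
have [z0 Zz0 ntz0]: exists2 z0, z0 \in Z & z0 != 1.
  by have [z0 Zz0 nt] := trivgPn _ (minnormal_neq1 minZ); exists z0.
exists (j z0); split=> //.
- apply/trivgP/subsetP=> q /setIP[]; rewrite defP => /imsetP[c Zc ->] Djc.
  have Dfc: f c \in D by rewrite -(groupMl _ (subsetP sZD c Zc)).
  have fc1: f c = 1.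
    apply/set1P; rewrite -[[set 1]]tiND inE Dfc Nf //.
    exact: (subsetP sZE).
  by rewrite inE /j fc1 mulg1 (kerZ c).
- split; first exact: equiv_hom_comp ehh ehjP.
  move=> n m Nn Nm /= eq_jh; have [[Zn fn] [Zm fm]] := (hP n Nn, hP m Nm).
  by rewrite -fn -fm; congr f; apply: injj eq_jh.
split; first by rewrite defP; apply: imset_f.
by rewrite fj //; apply: contraNneq ntz0 => /(kerZ _ Zz0)->.
Qed.

End Structure.

(** * Walks of length 3 *)

Section Walk.

Variables (gT : finGroupType) (G : {group gT}) (x x' : gT).
Hypotheses (solG : solvable G) (Gx : x \in G) (Gx' : x' \in G).
Implicit Types (D E K M N P S : {group gT}).

(** As for [common_neighbour_mod], generation is only required modulo K. *)
Definition walk_mod (K : {set gT}) := exists y1 y2,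
  [/\ y1 \in G /\ y2 \in G, K * <<[set y1; x]>> = G, K * <<[set y1; y2]>> = G
    & K * <<[set y2; x']>> = G].

Hypotheses (nbx : exists2 y, y \in G & <<[set y; x]>> = G).
Hypotheses (nbx' : exists2 y, y \in G & <<[set y; x']>> = G).
Hypothesis modN : forall N, minnormal N G -> N \subset G -> walk_mod N.
Hypothesis stuck : ~ walk_mod 1.

(** If no walk from x to x' exists at all, no correction can produce one. *)
Lemma stuck_broken y1 y2 N : N \subset G -> y1 \in G -> y2 \in G ->
    <<[set y1; x]>> = G -> <<[set y2; x']>> = G -> N * <<[set y1; y2]>> = G ->
  broken_walk G x y1 y2 x' N.
Proof.
move=> sNG Gy1 Gy2 gx gx' gy; split=> // n1 n2 Nn1 Nn2 g1 g2 g12; case: stuck.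
exists (y1 * n1), (y2 * n2); rewrite !mul1g; split=> //.
by rewrite !groupM ?(subsetP sNG n1) ?(subsetP sNG n2).
Qed.

Lemma stuck_base N : minnormal N G -> N \subset G ->
  exists y1 y2, broken_walk G x y1 y2 x' N.
Proof.
move=> minN sNG; have abN := solvable_minnormal_abelian solG minN sNG.
have [y1 [y2 [[Gy1 Gy2] gx gy gx']]] := modN minN sNG.
have [[z1 Gz1 gz1] [z2 Gz2 gz2]] := (nbx, nbx').
have [n1 Nn1 g1] : exists2 n1, n1 \in N & <<[set y1 * n1; x]>> = G.
  by apply: (gaschutz1 minN sNG abN _ Gz1 gz1) => //; rewrite sub1set.
have [n2 Nn2 g2] : exists2 n2, n2 \in N & <<[set y2 * n2; x']>> = G.
  by apply: (gaschutz1 minN sNG abN _ Gz2 gz2) => //; rewrite sub1set.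
have Gy1n: y1 * n1 \in G by rewrite groupM // (subsetP sNG).
have Gy2n: y2 * n2 \in G by rewrite groupM // (subsetP sNG).
exists (y1 * n1), (y2 * n2); apply: stuck_broken => //.
apply: (gen_mulN1 minN sNG) => //; rewrite ?sub1set //.
rewrite setUC; apply: (gen_mulN1 minN sNG) => //; rewrite ?sub1set //.
by rewrite setUC.
Qed.

Lemma broken_over (z y1 y2 z' : gT) N : minnormal N G -> N \subset G ->
    broken_walk G z y1 y2 z' N ->
  exists2 M, M \in [complements to N in G] & [set z] \subset M.
Proof.
move=> minN sNG brk; have abN := solvable_minnormal_abelian solG minN sNG.
have [card2 _] := card_bad_x minN sNG abN brk.
have [a] : exists a, a \in bad G N [set z] y1.
  apply/set0Pn; rewrite -cards_eq0; apply/eqP=> card0.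
  by move: card2; rewrite card0 => /esym/eqP; rewrite eqn0Ngt cardG_gt0.
by case/badP=> _ [M [cM szM _]]; exists M.
Qed.

Lemma walk_compl1 N : minnormal N G -> N \subset G ->
  exists2 M, M \in [complements to N in G] & [set x] \subset M.
Proof.
move=> minN sNG; have [y1 [y2 brk]] := stuck_base minN sNG.
exact: broken_over brk.
Qed.

Lemma walk_compl2 N : minnormal N G -> N \subset G ->
  exists2 M, M \in [complements to N in G] & [set x'] \subset M.
Proof.
move=> minN sNG; have [y1 [y2 /broken_walk_sym brk]] := stuck_base minN sNG.
exact: broken_over brk.
Qed.

Lemma walk_complG N : minnormal N G -> N \subset G ->
  exists M, M \in [complements to N in G].
Proof. by move=> minN /(walk_compl1 minN)[M]; exists M. Qed.

Lemma walk_nonnilpotent : ~~ nilpotent G.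
Proof.
apply/negP=> nilG; case: stuck.
have abG := nilpotent_normal_abelian walk_complG (normal_refl G) nilG.
have sG z : z \in G -> [set z] \subset G by rewrite sub1set.
have := abelian_compl_over abG (sG x Gx) walk_compl1.
have := abelian_compl_over abG (sG x' Gx') walk_compl2.
rewrite !sub1set !inE => /eqP x'1 /eqP x1; have [y Gy gy] := nbx.
have gy1: <<[set y; 1]>> = G by rewrite -gy x1.
exists y, y; rewrite !mul1g x1 x'1; split=> //.
rewrite setUid -gy1; apply/eqP; rewrite eqEsubset genS ?sub1set ?setU11 //=.
by rewrite gen_subG subUset !sub1set cycle_id group1.
Qed.

Section Transfer.

Variables (E S1 S2 : {group gT}).
Hypotheses (nsEG : E <| G) (abE : abelian E).
Hypotheses (sS1G : S1 \subset G) (defG1 : E * S1 = G) (tiES1 : E :&: S1 = 1).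
Hypotheses (sS2G : S2 \subset G) (defG2 : E * S2 = G) (tiES2 : E :&: S2 = 1).
Hypotheses (supE1 : supplements_split G E S1) (supE2 : supplements_split G E S2).
Hypotheses (S1x : x \in S1) (S2x' : x' \in S2).

(** Let f' take the value [k2, v] at u2.  If f and f' differ, they differ on a
    minimal normal P avoiding the complement generated by y1 and y2, so that the
    walk is broken for P as well.  Transport v to w in P.  Conjugation by w
    multiplies y1 and y2 by [k1, w] and [k2, w] and does not repair the middle
    edge, so these corrections are both good or both not; by [good_homE] this
    makes f and f' agree on P. *)
Lemma broken_transfer N y1 y2 k1 u1 k2 u2 v f : minnormal N G -> N \subset E ->
    broken_walk G x y1 y2 x' N ->
    k1 \in S1 -> u1 \in E -> y1 = k1 * u1 ->
    k2 \in S2 -> u2 \in E -> y2 = k2 * u2 ->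
    v \in N -> equiv_hom G E N f -> f u1 = [~ k1, v] -> f u2 = [~ k2, v].
Proof.
move=> minN sNE brk S1k1 Eu1 def_y1 S2k2 Eu2 def_y2 Nv ehf fu1.
have [sEG nEG] := andP nsEG; have sNG := subset_trans sNE sEG.
have abN := abelianS sNE abE; have nNG := minnormal_norm minN.
have nsNG: N <| G by apply/andP.
have [[_ Gy1 Gy2 _] gx gx' gy _] := brk.
have Gk1 := subsetP sS1G k1 S1k1; have Gk2 := subsetP sS2G k2 S2k2.
have brk' := broken_walk_sym brk.
have Nc2: [~ k2, v] \in N.
  by rewrite commgEr groupM // memJ_norm ?groupV // (subsetP nNG).
have [f' [ehf' fu2 _]] := good_hom nsEG abE sS2G defG2 tiES2 supE2 S2x' S2k2 Eu2
  def_y2 gx' minN sNE brk' Nc2.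
pose df z := f z * (f' z)^-1.
have ehd: equiv_hom G E N df := equiv_hom_div abN ehf ehf'.
have [/eqP df1 | dfu2] := boolP (df u2 == 1).
  by move/eqP: df1; rewrite /df fu2 -eq_mulgV1 => /eqP.
have [L [cL Ly1 Ly2]] := broken_base minN sNG abN brk.
have [ED _] := compl_conj_join nsEG abE sS1G minN sNE supE1 cL.
have [P [g [w [minP sPE tiPD [ehg injg] [Pw dfw]]]]] :=
  detecting_minnormal nsEG abE walk_complG minN sNE ED ehd Eu2 dfu2.
have sPG := subset_trans sPE sEG; have abP := abelianS sPE abE.
have sLG := compl_sub cL.
have cLP: L \in [complements to P in G].
  have tiPL: P :&: L = 1 by rewrite -tiPD /= setIA (setIidPl sPE).
  apply/complP; split=> //; apply/eqP; rewrite eqEcard mul_subG //=.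
  have /complP[tiNL <-] := cL; rewrite !TI_cardMg // leq_mul2r.
  have [Pg _ _] := ehg; rewrite -(card_in_imset injg) subset_leq_card ?orbT //.
  by apply/subsetP=> _ /imsetP[n Nn ->]; apply: Pg.
have genL: <<[set y1; y2]>> = L.
  by apply: (gen_compl minN abN cL) => //; rewrite subUset !sub1set Ly1.
have brkP: broken_walk G x y1 y2 x' P.
  by apply: stuck_broken => //; rewrite genL; case/complP: cLP.
have Pgv: g v \in P by case: ehg => Pg _ _; apply: Pg.
have Egv := subsetP sPE _ Pgv; have Ggv := subsetP sEG _ Egv.
have comm_y y k u : y = k * u -> u \in E -> k \in G -> y ^ g v = y * [~ k, g v].
  move=> -> Eu Gk; rewrite conjg_mulR; congr (_ * _).
  have nEk := subsetP nEG k Gk.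
  apply: (commg_mulE abE Eu Egv); rewrite memJ_norm; [by rewrite groupV | exact: nEk].
(* Both generators lie in the conjugate of L by g v. *)
have neqG: <<[set y1 * [~ k1, g v]; y2 * [~ k2, g v]]>> <> G.
  apply: (compl_broken minP sPG (compl_conj minP cLP Ggv)).
    by rewrite -(comm_y _ _ _ def_y1) // memJ_conjg.
  by rewrite -(comm_y _ _ _ def_y2) // memJ_conjg.
have commg k : k \in G -> g [~ k, v] = [~ k, g v].
  by move=> Gk; apply: (equiv_hom_commg nsNG ehg Gk Nv).
have Pc k : k \in G -> [~ k, g v] \in P.
  move=> Gk; have nPk := subsetP (minnormal_norm minP) k Gk.
  by rewrite commgEr groupM // memJ_norm ?groupV.
have := good_iff minP sPG abP brkP (Pc k1 Gk1) (Pc k2 Gk2) neqG.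
have Ew := subsetP sPE w Pw.
have eh1 := equiv_hom_comp ehf ehg; have eh2 := equiv_hom_comp ehf' ehg.
have brkP' := broken_walk_sym brkP.
have /(_ w Pw) /= := good_homE nsEG abE sS1G defG1 tiES1 supE1 S1x S1k1 Eu1
  def_y1 gx minP sPE brkP eh1.
have /(_ w Pw) /= := good_homE nsEG abE sS2G defG2 tiES2 supE2 S2x' S2k2 Eu2
  def_y2 gx' minP sPE brkP' eh2.
rewrite fu1 fu2 !commg // => eq2 eq1 eq_good.
case/negP: dfw; rewrite /df -eq_mulgV1; apply/eqP/injg.
- by case: ehf => Nf _ _; apply: Nf.
- by case: ehf' => Nf' _ _; apply: Nf'.
by rewrite eq1 eq2 eq_good.
Qed.

End Transfer.

(** The complement generated by y1 and y2 gives w in N and the projection f0 to N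
    with f0 u1 = [k1, w], hence f0 u2 = [k2, w].  Replace y1 by y1 n with n <> 1
    good, and let f take the value [k1, w] at u1 n; then again f u2 = [k2, w], so
    f = f0 and f0 n = 1, although f0 is the identity on N. *)
Lemma no_walkless_group : False.
Proof.
have nnil := walk_nonnilpotent.
have [E [S [nsEG abE ntE tiEC supE]]] := nonnilpotent_split solG walk_complG nnil.
have [sEG nEG] := andP nsEG.
have sxG: [set x] \subset G by rewrite sub1set.
have sx'G: [set x'] \subset G by rewrite sub1set.
have [S1 [sS1G + defG1 tiES1]] := compl_over_abelian nsEG abE sxG
  (fun N minN sNE => walk_compl1 minN (subset_trans sNE sEG)).
have [S2 [sS2G + defG2 tiES2]] := compl_over_abelian nsEG abE sx'G
  (fun N minN sNE => walk_compl2 minN (subset_trans sNE sEG)).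
rewrite !sub1set => S2x' S1x.
have supE1 := supplements_split_compl supE sS1G defG1 tiES1.
have supE2 := supplements_split_compl supE sS2G defG2 tiES2.
have [N minN sNE] := minnormal_exists ntE nEG.
have sNG := subset_trans sNE sEG; have abN := abelianS sNE abE.
have nNG := minnormal_norm minN; have nsNG: N <| G by apply/andP.
have [y1 [y2 brk]] := stuck_base minN sNG.
have [[_ Gy1 Gy2 _] gx gx' gy _] := brk.
have split_y (S0 : {group gT}) y : E * S0 = G -> S0 \subset G -> y \in G ->
    exists k u, [/\ k \in S0, u \in E & y = k * u].
  move=> defG0 sS0G; rewrite -defG0 -normC ?(subset_trans sS0G) //.
  by case/mulsgP=> k u Sk Eu ->; exists k, u.
have [k1 [u1 [S1k1 Eu1 def_y1]]] := split_y S1 y1 defG1 sS1G Gy1.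
have [k2 [u2 [S2k2 Eu2 def_y2]]] := split_y S2 y2 defG2 sS2G Gy2.
have Gk1 := subsetP sS1G k1 S1k1.
have [L [cL Ly1 Ly2]] := broken_base minN sNG abN brk.
have [ED [w Nw defL]] := compl_conj_join nsEG abE sS1G minN sNE supE1 cL.
set D := (E :&: L)%G in ED.
have [ehD DN DD] := equiv_hom_proj nsEG abE nsNG sNE ED.
set f0 := remgr D N in ehD DN DD.
have [Nf0 f0M _] := ehD.
have Ew := subsetP sNE w Nw; have Gw := subsetP sEG w Ew.
have Nc1: [~ k1, w] \in N.
  by rewrite commgEr groupM // memJ_norm ?groupV // (subsetP nNG).
have Ec1 := subsetP sNE _ Nc1.
have f0u1: f0 u1 = [~ k1, w].
  have Ewv: w^-1 \in E by rewrite groupV.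
  have nEk1 := subsetP nEG k1 Gk1; have nNk1 := subsetP nNG k1 Gk1.
  have Nc'1: [~ k1, w^-1] \in N by rewrite commgEr groupM ?groupV // memJ_norm ?groupV.
  have Ec'1 := subsetP sNE _ Nc'1.
  have [/andP[_ nDG] defDE _] := normal_complP _ _ _ _ ED.
  have sDE: D \subset E by rewrite -defDE mulG_subr.
  have defDS: D <*> S1 = D * S1 by rewrite norm_joinEr ?(subset_trans sS1G).
  have Duc: u1 * [~ k1, w^-1] \in D.
    have DSk: k1 \in D <*> S1 by rewrite (subsetP (joing_subr _ _)).
    have: u1 * [~ k1, w^-1] \in E :&: (D <*> S1).
      rewrite inE groupM //= -(groupMl _ DSk) mulgA -def_y1.
      have <-: [~ y1, w^-1] = [~ k1, w^-1].
        by rewrite def_y1; apply: (commg_mulE abE Eu1 Ewv); rewrite memJ_norm ?groupV.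
      by rewrite -conjg_mulR /= defDS -mem_conjg -defL.
    rewrite defDS setIC -group_modl //.
    by rewrite [S1 :&: E]setIC tiES1 mulg1.
  have := DD _ (groupM Eu1 Ec'1); rewrite Duc f0M // (DN _ Nc'1) => /eqP fc1.
  rewrite -(mulgK [~ k1, w^-1] (f0 u1)) fc1 mul1g.
  rewrite !commgEr invMg !invgK -conjVg; apply: (centsP abN); rewrite // memJ_norm ?groupV //.
have f0u2: f0 u2 = [~ k2, w].
  exact: (broken_transfer nsEG abE sS1G defG1 tiES1 sS2G defG2 tiES2 supE1 supE2
    S1x S2x' minN sNE brk S1k1 Eu1 def_y1 S2k2 Eu2 def_y2 Nw ehD f0u1).
have [n good_n ntn]: exists2 n, n \in good G N x y1 & n != 1.
  have [/exists_inP[n] | no_n] := boolP [exists n in good G N x y1, n != 1].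
    by exists n.
  (* A normal subgroup of order at most 2 is central, but C_E(G) = 1. *)
  have le2N: #|N| <= 2.
    rewrite -(card_good minN sNG abN brk).
    apply: (@leq_mul _ _ 1 2) => //; rewrite -(cards1 (1 : gT)).
    rewrite subset_leq_card //; apply/subsetP=> n good_n; rewrite inE.
    by apply: contraR no_n => ntn; apply/exists_inP; exists n.
  case/negP: (minnormal_neq1 minN); rewrite -subG1 -tiEC subsetI sNE.
  apply/centsP=> a Na g Gg; apply/commgP/conjg_fixP.
  have [-> | nta] := eqVneq a 1; first by rewrite conj1g.
  have defN: [set 1; a] = N.
    apply/eqP; rewrite eqEcard subUset !sub1set group1 Na cards2 eq_sym nta.
    exact: le2N.
  have: a ^ g \in [set 1; a] by rewrite defN memJ_norm ?(subsetP nNG).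
  by rewrite !inE conjg_eq1 (negPf nta) => /eqP.
have Nn : n \in N := subsetP (good_sub G N x y1) n good_n.
have En := subsetP sNE n Nn.
have Gy1n : y1 * n \in G by rewrite groupM // (subsetP sNG).
have brkn: broken_walk G x (y1 * n) y2 x' N.
  apply: stuck_broken => //; first by move: good_n; rewrite inE => /andP[_ /eqP].
  by apply: (gen_mulN1 minN sNG) => //; rewrite sub1set.
have def_y1n: y1 * n = k1 * (u1 * n) by rewrite def_y1 mulgA.
have [[_ _ _ _] gxn _ _ _] := brkn.
have [f [ehf fu1 _]] := good_hom nsEG abE sS1G defG1 tiES1 supE1 S1x S1k1
  (groupM Eu1 En) def_y1n gxn minN sNE brkn Nc1.
have fu2: f u2 = [~ k2, w].
  exact: (broken_transfer nsEG abE sS1G defG1 tiES1 sS2G defG2 tiES2 supE1 supE2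
    S1x S2x' minN sNE brkn S1k1 (groupM Eu1 En) def_y1n S2k2 Eu2 def_y2 Nw ehf fu1).
have eq_f: {in E, forall z, f z = f0 z}.
  apply: (equiv_hom_gen_eq nsEG sS2G tiES2 S2x' S2k2 Eu2 def_y2 gx' abN ehf ehD).
  by rewrite fu2.
case/eqP: ntn; apply: (mulgI (f0 u1)); rewrite mulg1 -{1}(DN n) // -f0M //.
by rewrite -eq_f ?groupM // fu1.
Qed.

End Walk.

(** * Chief factors as modules *)

Section ChiefModule.

Variables (gT : finGroupType) (G K : {group gT}) (V : {group coset_of K}).
Hypotheses (nsKG : K <| G) (minV : minnormal V (G / K)) (sVG : V \subset G / K).

Lemma chief_actsP :
  {acts G, on group V | ('J \o coset_morphism K)%gact}.
Proof.
have nVG := minnormal_norm minV; have nKG := normal_norm nsKG.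
split; last exact: subsetT.
apply/subsetP=> g Gg; have Ng := subsetP nKG g Gg.
have Vg: coset K g \in 'N(V) by rewrite (subsetP nVG) ?mem_quotient.
rewrite !inE /=; move: Ng; rewrite inE => -> /=.
by apply/subsetP=> v Vv; rewrite inE memJ_norm.
Qed.

(** Conjugation restricted to V and extended trivially: a group action on V must be
    trivial outside V. *)
Definition chief_action := (<[chief_actsP]>)%gact.

Lemma chief_actionE v g : v \in V -> g \in G -> chief_action v g = v ^ coset K g.
Proof. by move=> Vv Gg; rewrite /= actbyE. Qed.

(** V = N / K is a complemented chief factor of G, and its endomorphisms over G and
    over G / K are the same functions. *)
Lemma End_gt2_conj_End : solvable G -> End_gt2 G -> [splits G / K, over V] ->
  ~~ (V \subset 'C(G / K)) -> 2 < #|conj_End (G / K) V|.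
Proof.
move=> solG endG splitV ncV; have [sKG nKG] := andP nsKG.
have nVG := minnormal_norm minV.
have abV : abelian V.
  by have [_ _ /is_abelemP[p _ /abelem_abelian]] :=
    minnormal_solvable minV sVG (quotient_sol K solG).
have actE := chief_actionE.
have nsVG: V <| G / K by apply/andP.
have [N defV sKN nsNG] := inv_quotientN nsKG nsVG.
have stabE (W : {group coset_of K}) : W \subset V ->
    [acts G, on W | chief_action] = (G / K \subset 'N(W)).
  move=> sWV; apply/idP/idP=> [actW | nWG].
    apply/subsetP=> _ /morphimP[g Ng Gg ->]; rewrite inE.
    apply/subsetP=> _ /imsetP[v Wv ->].
    have Vv := subsetP sWV v Wv.
    by rewrite -(actE _ _ Vv Gg) (acts_act actW).
  apply/subsetP=> g Gg; rewrite !inE Gg /=; apply/subsetP=> v Wv; rewrite inE.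
  have Vv := subsetP sWV v Wv.
  by rewrite (actE _ _ Vv Gg) memJ_norm // (subsetP nWG) ?mem_quotient.
have irrV: irreducible_module chief_action.
  rewrite /irreducible_module abV /=; apply/mingroupP; split.
    by rewrite stabE // nVG andbT (minnormal_neq1 minV).
  move=> W /andP[ntW actW] sWV; case/mingroupP: minV => _; apply=> //.
  by rewrite ntW -stabE.
have ntV: nontrivial_module chief_action.
  apply: contra ncV => cGV; rewrite centsC; apply/subsetP=> _ /morphimP[g Ng Gg ->].
  apply/centP=> v Vv; apply/commute_sym/commgP/conjg_fixP.
  by rewrite -(actE _ _ Vv Gg); apply: (astab_act (subsetP cGV g Gg)).
have chiefV: exists X Y : {group gT}, complemented_chief_factor G X Y /\
    module_isog_factor chief_action X Y.
  exists N, K; split.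
    rewrite /complemented_chief_factor /chief_factor -defV splitV nsNG !andbT.
    have nsKN : K <| N := normalS sKN (normal_sub nsNG) nsKG.
    by apply: minnormal_maxnormal nsKN nKG _; rewrite -defV.
  have idM: {in V &, {morph (@id (coset_of K)) : v w / v * w}} by [].
  exists (Morphism idM).
    apply/isomP; split; first by apply/injmP=> v w.
    by rewrite morphimEdom; apply: etrans (imset_id _) defV.
  by move=> v g Vv Gg; rewrite /= -[RHS]actE.
apply: leq_trans (endG _ V chief_action irrV ntV chiefV) _.
apply/subset_leq_card/subsetP=> f; rewrite !inE => /and3P[fVV fM /forall_inP fJ].
rewrite fVV fM /=; apply/forall_inP=> v Vv.
apply/forall_inP=> _ /morphimP[g Ng Gg ->].
have Vfv: f v \in V by case/pffun_onP: fVV => _; apply; apply: image_f.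
by have /forall_inP/(_ g Gg) := fJ v Vv; rewrite !actE.
Qed.

End ChiefModule.

(** * Descent along normal subgroups *)

(** Induction on the index of K. *)
Lemma normal_descent (gT : finGroupType) (G : {group gT}) (P : {group gT} -> Prop) :
    (forall K : {group gT}, K <| G ->
       (forall N : {group gT}, N <| G -> K \proper N -> P N) -> P K) ->
  P 1%G.
Proof.
move=> step; suffices descend n (K : {group gT}) : #|G : K| < n -> K <| G -> P K.
  exact: descend (ltnSn _) (normal1 G).
elim: n K => // n IHn K leKn nsKG; apply: step => // N nsNG ltKN.
apply: IHn => //; rewrite ltnS in leKn; apply: leq_trans leKn.
by rewrite -(Lagrange_index (normal_sub nsNG) (proper_sub ltKN)) ltn_Pmulr ?indexg_gt1 ?proper_subn.
Qed.

Section Quotient.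

Variables (gT : finGroupType) (G K : {group gT}).
Hypothesis nsKG : K <| G.
Let nKG : G \subset 'N(K) := normal_norm nsKG.

Lemma quotient_gen_eq (N : {group gT}) (Z : {set gT}) : K \subset N -> N <| G ->
    Z \subset G ->
  N * <<Z>> = G <-> (N / K) * <<Z / K>> = G / K.
Proof.
move=> sKN nsNG sZG; have nKZ := subset_trans sZG nKG.
have nKN := subset_trans (normal_sub nsNG) nKG.
rewrite -quotient_gen // -quotientMl //; split=> [-> // | eqG].
have sNZG: N * <<Z>> \subset G by apply: mul_subG (normal_sub nsNG) _; rewrite gen_subG.
apply/eqP; rewrite eqEsubset sNZG -(mulSGid sKN) -mulgA -quotientSK //.
by rewrite eqG /=.
Qed.

Lemma quotient_entries b (X : {set gT}) (Y : 'I_b -> gT) : X \subset G ->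
  entries Y \subset G ->
  (X :|: entries Y) / K = X / K :|: entries (fun i => coset K (Y i)).
Proof.
move=> sXG sYG; rewrite quotientU; congr (_ :|: _).
rewrite /quotient morphimEsub ?(subset_trans sYG) // /entries -imset_comp.
exact: eq_imset.
Qed.

Lemma repr_in_quotient (z : coset_of K) : z \in G / K -> repr z \in G.
Proof.
move=> GKz; rewrite -(quotientGK nsKG); apply/morphpreP; split; last by rewrite /= coset_reprK.
exact: (subsetP (coset_norm z) _ (mem_repr_coset z)).
Qed.

End Quotient.

(** Decidable because the tuples over a finite group form a finite type. *)
Lemma common_neighbour_modP (gT : finGroupType) (G : {group gT}) b (K X1 X2 : {set gT}) :
  common_neighbour_mod G b K X1 X2 \/ ~ common_neighbour_mod G b K X1 X2.
Proof.
pose ok (Y : 'I_b -> gT) := [&& entries Y \subset G, K * <<X1 :|: entries Y>> == G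
   & K * <<X2 :|: entries Y>> == G].
have [/existsP[Y /and3P[sY /eqP g1 /eqP g2]] | /existsPn no_Y] :=
    boolP [exists Y : {ffun 'I_b -> gT}, ok Y].
  by left; exists Y.
right=> -[Y [sY g1 g2]]; case/negP: (no_Y [ffun i => Y i]).
have eqY: entries [ffun i => Y i] = entries Y.
  by apply: eq_imset => i; rewrite ffunE.
by rewrite /ok eqY sY g1 g2 eqxx.
Qed.

Section Theorems.

Variables (gT : finGroupType) (G : {group gT}).
Hypothesis solG : solvable G.

Theorem common_neighbour b (X1 X2 : {set gT}) : X1 \subset G -> X2 \subset G ->
    has_neighbour G b X1 -> has_neighbour G b X2 ->
    1 < b \/ b = 1%N /\ End_gt2 G ->
  common_neighbour_mod G b 1 X1 X2.
Proof.
move=> sX1G sX2G nb1 nb2 cond.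
apply: (@normal_descent _ G (fun K : {group gT} => common_neighbour_mod G b K X1 X2)).
move=> K nsKG IH; have nKG := normal_norm nsKG; set Q := (G / K)%G.
have solQ : solvable Q by apply: quotient_sol.
have nbQ (X : {set gT}) : X \subset G -> has_neighbour G b X -> has_neighbour Q b (X / K).
  move=> sXG [Y [sYG genY]]; exists (fun i => coset K (Y i)); split.
    apply/entries_subP=> i; rewrite mem_quotient //; exact: (entries_subP _ _ sYG).
  rewrite -(quotient_entries nsKG) // -quotient_gen ?genY //.
  by rewrite subUset !(subset_trans _ nKG).
have modQ (V : {group coset_of K}) : minnormal V Q -> V \subset Q ->
    common_neighbour_mod Q b V (X1 / K) (X2 / K).
  move=> minV sVQ; have nsVQ: V <| G / K by rewrite /normal sVQ minnormal_norm.
  have [N defV sKN nsNG] := inv_quotientN nsKG nsVQ.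
  have ltKN: K \proper N.
    rewrite properEneq sKN andbT; apply: contraNneq (minnormal_neq1 minV) => eqKN.
    by rewrite defV -eqKN trivg_quotient.
  have [Y [sYG g1 g2]] := IH N nsNG ltKN.
  exists (fun i => coset K (Y i)); rewrite defV /= -!(quotient_entries nsKG) //; split.
  - apply/entries_subP=> i; rewrite mem_quotient //; exact: (entries_subP _ _ sYG).
  - by apply/(quotient_gen_eq nsKG) => //; rewrite subUset sX1G.
  - by apply/(quotient_gen_eq nsKG) => //; rewrite subUset sX2G.
have [Y [sYQ g1 g2]]: common_neighbour_mod Q b 1 (X1 / K) (X2 / K).
  have [//|stuck] := @common_neighbour_modP _ Q b 1 (X1 / K) (X2 / K).
  have sXQ (X : {set gT}) : X \subset G -> X / K \subset Q by apply: quotientS.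
  case: cond => [b_ge2 | [b1 endG]].
    have := mincex_length_lt2 solQ (sXQ _ sX1G) (sXQ _ sX2G) (nbQ _ sX1G nb1)
      (nbQ _ sX2G nb2) modQ stuck.
    by rewrite ltnNge b_ge2.
  move: nbQ modQ stuck nb1 nb2; rewrite b1 => nbQ modQ stuck nb1 nb2.
  apply: common_neighbour1 => //; try exact: sXQ; try exact: nbQ.
  by move=> V minV sVQ; apply: End_gt2_conj_End.
have /entries_subP QY := sYQ.
exists (fun i => repr (Y i)).
have sYG: entries (fun i => repr (Y i)) \subset G.
  by apply/entries_subP=> i; apply: repr_in_quotient.
have eqY : entries (fun i => coset K (repr (Y i))) = entries Y.
  by apply: eq_imset => i; rewrite coset_reprK.
split=> //.
  apply/(quotient_gen_eq nsKG) => //; first by rewrite subUset sX1G.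
  by rewrite (quotient_entries nsKG) // eqY trivg_quotient.
apply/(quotient_gen_eq nsKG) => //; first by rewrite subUset sX2G.
by rewrite (quotient_entries nsKG) // eqY trivg_quotient.
Qed.

End Theorems.

Lemma walk_modP (gT : finGroupType) (G : {group gT}) x x' (K : {set gT}) :
  walk_mod G x x' K \/ ~ walk_mod G x x' K.
Proof.
pose ok y1 y2 := [&& (y1 \in G) && (y2 \in G), K * <<[set y1; x]>> == G,
   K * <<[set y1; y2]>> == G & K * <<[set y2; x']>> == G].
have [/existsP[y1 /existsP[y2 /and4P[/andP[Gy1 Gy2] /eqP g1 /eqP g2 /eqP g3]]] | no_w] :=
  boolP [exists y1, exists y2, ok y1 y2]; first by left; exists y1, y2.
right=> -[y1 [y2 [[Gy1 Gy2] g1 g2 g3]]]; case/existsP: no_w.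
by exists y1; apply/existsP; exists y2; rewrite /ok Gy1 Gy2 g1 g2 g3 eqxx.
Qed.

Theorem walk_exists (gT : finGroupType) (G : {group gT}) x x' : solvable G ->
    x \in G -> x' \in G ->
    (exists2 y, y \in G & <<[set y; x]>> = G) ->
    (exists2 y, y \in G & <<[set y; x']>> = G) ->
  walk_mod G x x' 1.
Proof.
move=> solG Gx Gx' nbx nbx'.
apply: (@normal_descent _ G (fun K : {group gT} => walk_mod G x x' K)).
move=> K nsKG IH; have nKG := normal_norm nsKG; set Q := (G / K)%G.
have solQ : solvable Q by apply: quotient_sol.
have q2 y z : y \in G -> z \in G -> [set y; z] / K = [set coset K y; coset K z].
  by move=> /(subsetP nKG) Ny /(subsetP nKG) Nz; rewrite quotientU !quotient_set1.
have s2 y z : y \in G -> z \in G -> [set y; z] \subset G.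
  by move=> Gy Gz; rewrite subUset !sub1set Gy.
have Qc y : y \in G -> coset K y \in Q by apply: mem_quotient.
have nbQ z : z \in G -> (exists2 y, y \in G & <<[set y; z]>> = G) ->
    exists2 y, y \in Q & <<[set y; coset K z]>> = Q.
  move=> Gz [y Gy gy]; exists (coset K y); first exact: Qc.
  by rewrite -q2 // -quotient_gen ?gy // (subset_trans (s2 _ _ Gy Gz)).
have modQ (V : {group coset_of K}) : minnormal V Q -> V \subset Q ->
    walk_mod Q (coset K x) (coset K x') V.
  move=> minV sVQ; have nsVQ: V <| G / K by rewrite /normal sVQ minnormal_norm.
  have [N defV sKN nsNG] := inv_quotientN nsKG nsVQ.
  have ltKN: K \proper N.
    rewrite properEneq sKN andbT; apply: contraNneq (minnormal_neq1 minV) => eqKN.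
    by rewrite defV -eqKN trivg_quotient.
  have [y1 [y2 [[Gy1 Gy2] g1 g2 g3]]] := IH N nsNG ltKN.
  exists (coset K y1), (coset K y2); rewrite defV /= -!q2 //; split.
  - by rewrite !Qc.
  - by apply/(quotient_gen_eq nsKG) => //; apply: s2.
  - by apply/(quotient_gen_eq nsKG) => //; apply: s2.
  - by apply/(quotient_gen_eq nsKG) => //; apply: s2.
have [[y1 [y2 [[Qy1 Qy2] g1 g2 g3]]] | stuck] := @walk_modP _ Q (coset K x) (coset K x') 1.
  have Gy1 := repr_in_quotient nsKG Qy1; have Gy2 := repr_in_quotient nsKG Qy2.
  have gen y z w : y \in G -> z \in G -> w = [set coset K y; coset K z] ->
      1 * <<w>> = Q -> K * <<[set y; z]>> = G.
    move=> Gy Gz -> gw; apply/(quotient_gen_eq nsKG) => //; first exact: s2.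
    by rewrite q2 // trivg_quotient.
  exists (repr y1), (repr y2); split=> //.
  - by apply: gen g1; rewrite ?coset_reprK.
  - by apply: gen g2; rewrite ?coset_reprK.
  - by apply: gen g3; rewrite ?coset_reprK.
by case: (no_walkless_group solQ (Qc _ Gx) (Qc _ Gx') (nbQ _ Gx nbx) (nbQ _ Gx' nbx')
  modQ stuck).
Qed.

(** * The generating graph *)

Section Graph.

Variables (gT : finGroupType) (G : {group gT}) (a b : nat).
Hypothesis le_ab : a <= b.
Implicit Types (s t : seq gT).

Local Notation star := (vertex (gen_graph_star G a b)).

Definition entry_seq (v : star) : seq gT := val (val (val v)).

Definition seq_adj s t :=
  (((size s == a) && (size t == b)) || ((size s == b) && (size t == a)))
  && (<<[set x in s ++ t]>> == G).

Lemma adjE (v w : star) : adj v w = seq_adj (entry_seq v) (entry_seq w).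
Proof. by []. Qed.

Lemma entry_seqP (v : star) :
  ((size (entry_seq v) == a) || (size (entry_seq v) == b)) /\ all [in G] (entry_seq v).
Proof. exact/andP/(valP (val v)). Qed.

Lemma vertex_seq s : (size s == a) || (size s == b) -> all [in G] s ->
  exists v : gen_vertex G a b, val (val v) = s :> seq gT.
Proof.
move=> sz_s Gs; have le_s : size s <= b.
  by case/orP: sz_s => /eqP ->.
have Ps : ((size (Bseq le_s) == a) || (size (Bseq le_s) == b)) && all [in G] (Bseq le_s).
  exact/andP.
by exists (@exist _ (fun r : b.-bseq gT =>
  ((size r == a) || (size r == b)) && all [in G] r) (Bseq le_s) Ps).
Qed.

Lemma seq_adj_sym s t : seq_adj s t = seq_adj t s.
Proof.
rewrite /seq_adj; congr (_ && _).
  by rewrite orbC andbC [(size s == a) && _]andbC.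
by congr (<<_>> == _); apply/setP=> x; rewrite !inE !mem_cat orbC.
Qed.

Lemma seq_adj_size s t : seq_adj s t ->
  ((size s == a) || (size s == b)) && ((size t == a) || (size t == b)).
Proof. by case/andP=> /orP[/andP[-> ->] | /andP[-> ->]] _; rewrite ?orbT. Qed.

Lemma star_of_seq s t : all [in G] s -> all [in G] t -> seq_adj s t ->
  exists v : star, entry_seq v = s.
Proof.
move=> Gs Gt st; have /andP[sz_s sz_t] := seq_adj_size st.
have [v def_v] := vertex_seq sz_s Gs; have [w def_w] := vertex_seq sz_t Gt.
have nv : ~~ @isolated (gen_graph G a b) v.
  apply/forallPn; exists w; rewrite negbK /= /gen_adj.
  by move: st; rewrite /seq_adj -def_v -def_w.
by exists (exist _ v nv).
Qed.

Lemma star_nb (v : star) : exists w : star, adj v w.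
Proof.
have /forallPn[w] := valP v; rewrite negbK => vw.
have wv: seq_adj (val (val w)) (entry_seq v) by rewrite seq_adj_sym.
have Gw: all [in G] (val (val w)) by case/andP: (valP w).
have [w' def_w] := star_of_seq Gw (entry_seqP v).2 wv.
by exists w'; rewrite adjE def_w.
Qed.

Lemma has_neighbour_seq c s t : all [in G] t -> size t = c ->
  <<[set x in s ++ t]>> = G -> has_neighbour G c [set x in s].
Proof.
move=> /allP Gt sz_t gst; exists (fun i => nth 1 t i); split.
  by apply/entries_subP=> i; apply: Gt; rewrite mem_nth ?sz_t.
rewrite -gst; congr <<_>>; apply/setP=> z; rewrite !inE mem_cat; congr (_ || _).
apply/imsetP/idP=> [[i _ ->] | tz]; first by rewrite mem_nth ?sz_t.
have lt_i : index z t < c by rewrite -sz_t index_mem.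
by exists (Ordinal lt_i); rewrite //= nth_index.
Qed.

Hypothesis solG : solvable G.

(** For c = 0 the empty sequence is the only candidate and is already a common
    neighbour. *)
Lemma common_neighbour_seq c s1 s2 t1 t2 : all [in G] s1 -> all [in G] s2 ->
    all [in G] t1 -> all [in G] t2 -> size t1 = c -> size t2 = c ->
    <<[set x in s1 ++ t1]>> = G -> <<[set x in s2 ++ t2]>> = G ->
    [\/ s1 = s2, End_gt2 G | c <> 1%N] ->
  exists t, [/\ all [in G] t, size t = c,
    <<[set x in s1 ++ t]>> = G & <<[set x in s2 ++ t]>> = G].
Proof.
move=> Gs1 Gs2 Gt1 Gt2 sz1 sz2 g1 g2 cond.
have [eq_s | neq_s] := eqVneq s1 s2; first by exists t1; rewrite -eq_s.
have [c0 | c_gt0] := posnP c.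
  exists [::]; rewrite c0 !cats0; split=> //.
    by move: g1; rewrite (size0nil (etrans sz1 c0)) cats0.
  by move: g2; rewrite (size0nil (etrans sz2 c0)) cats0.
have setG s : all [in G] s -> [set x in s] \subset G.
  by move=> /allP Gs; apply/subsetP=> z; rewrite inE => /Gs.
have cond' : 1 < c \/ c = 1%N /\ End_gt2 G.
  have [c1 | neq1] := eqVneq c 1%N; last by left; lia.
  right; split=> //; case: cond => [eq_s | // | neq1].
    by rewrite eq_s eqxx in neq_s.
  by case: neq1.
have [Y [sYG gY1 gY2]] := common_neighbour solG (setG _ Gs1) (setG _ Gs2)
  (has_neighbour_seq Gt1 sz1 g1) (has_neighbour_seq Gt2 sz2 g2) cond'.
exists [seq Y i | i <- enum 'I_c].
have set_cat s : [set x in s ++ [seq Y i | i <- enum 'I_c]] = [set x in s] :|: entries Y.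
  apply/setP=> z; rewrite !inE mem_cat; congr (_ || _).
  by apply/mapP/imsetP=> [[i _ ->] | [i _ ->]]; exists i; rewrite ?mem_enum.
rewrite !set_cat size_map size_enum_ord; split=> //; last 2 first.
- by rewrite mul1g in gY1.
- by rewrite mul1g in gY2.
by apply/allP=> _ /mapP[i _ ->]; apply: (entries_subP _ _ sYG).
Qed.

Section CommonStar.

Variables c d : nat.
Hypothesis cd : (c = a /\ d = b) \/ (c = b /\ d = a).

Lemma seq_adj_sizeE s t : size s = c -> seq_adj s t ->
  size t = d /\ <<[set x in s ++ t]>> = G.
Proof.
move=> sz_s /andP[sz /eqP ->]; split=> //; move: sz; rewrite sz_s.
by case: cd => -[-> ->] /orP[/andP[/eqP ? /eqP ?] | /andP[/eqP ? /eqP ?]]; congruence.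
Qed.

Lemma common_star_nb (v1 v2 : star) :
    size (entry_seq v1) = c -> size (entry_seq v2) = c ->
    [\/ entry_seq v1 = entry_seq v2, End_gt2 G | d <> 1%N] ->
  exists w : star, adj v1 w /\ adj v2 w.
Proof.
move=> sz1 sz2 cond; have [w1] := star_nb v1; have [w2] := star_nb v2.
rewrite !adjE => adj2 adj1.
have [szt1 g1] := seq_adj_sizeE sz1 adj1; have [szt2 g2] := seq_adj_sizeE sz2 adj2.
have [t [Gt sz_t gt1 gt2]] := common_neighbour_seq (entry_seqP v1).2 (entry_seqP v2).2
  (entry_seqP w1).2 (entry_seqP w2).2 szt1 szt2 g1 g2 cond.
have adjt s : size s = c -> <<[set x in s ++ t]>> = G -> seq_adj s t.
  by rewrite /seq_adj => -> ->; rewrite sz_t eqxx andbT;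
    case: cd => -[-> ->]; rewrite !eqxx ?orbT.
have [|w def_w] := star_of_seq Gt (entry_seqP v1).2.
  by rewrite seq_adj_sym; apply: adjt.
by exists w; rewrite !adjE def_w; split; apply: adjt.
Qed.

End CommonStar.

Local Notation dist_le := (fun n (v w : star) => le_ext (dist v w) n).

Lemma star_adj_sym (v w : star) : adj v w = adj w v.
Proof. exact: adj_sym. Qed.

Lemma dist_leW m n (v w : star) : m <= n -> dist_le m v w -> dist_le n v w.
Proof.
move=> le_mn /dist_leP[p [vp lp sp]]; apply/dist_leP; exists p; split=> //.
exact: leq_trans le_mn.
Qed.

Lemma dist_cons n (u v w : star) : adj u v -> dist_le n v w -> dist_le n.+1 u w.
Proof.
move=> uv /dist_leP[p [vp lp sp]]; apply/dist_leP; exists (v :: p); split=> //; exact/andP.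
Qed.

Lemma dist_adj (v w : star) : adj v w -> dist_le 1%N v w.
Proof. by move=> vw; apply/dist_leP; exists [:: w]; split=> //; apply/andP. Qed.

Lemma dist_symm n (v w : star) : dist_le n v w -> dist_le n w v.
Proof.
case/dist_leP=> p [vp lp sp]; apply/dist_leP.
exists (rev (belast v p)); rewrite size_rev size_belast -lp rev_path; split=> //.
  by rewrite (eq_path (e' := @adj (gen_graph_star G a b))) // => y z; rewrite star_adj_sym.
by case: p {vp lp sp} => //= y p; rewrite rev_cons last_rcons.
Qed.

Lemma star_dist2 c d (v w : star) : (c = a /\ d = b) \/ (c = b /\ d = a) ->
    size (entry_seq v) = c -> size (entry_seq w) = c ->
    [\/ entry_seq v = entry_seq w, End_gt2 G | d <> 1%N] -> dist_le 2 v w.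
Proof.
move=> cd sz_v sz_w cond; have [u [vu wu]] := common_star_nb cd sz_v sz_w cond.
by apply: dist_cons vu _; apply: dist_adj; rewrite star_adj_sym.
Qed.

Lemma star_nb_size c d (v : star) : (c = a /\ d = b) \/ (c = b /\ d = a) ->
  size (entry_seq v) = c -> exists2 w : star, adj v w & size (entry_seq w) = d.
Proof.
move=> cd sz_v; have [w vw] := star_nb v; exists w => //.
by have [] := seq_adj_sizeE cd sz_v vw.
Qed.

Let ab : (a = a /\ b = b) \/ (a = b /\ b = a). Proof. by left. Qed.
Let ba : (b = a /\ a = b) \/ (b = b /\ a = a). Proof. by right. Qed.

Lemma star_size (v : star) : size (entry_seq v) = a \/ size (entry_seq v) = b.
Proof. by have [/orP[/eqP ? | /eqP ?] _] := entry_seqP v; [left | right]. Qed.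

(** Vertices of length a have a common neighbour also when b = 1, since then
    a = 0 and there is only one of them.  Vertices of length b are joined through
    neighbours of length a, unless they have a common neighbour themselves. *)
Lemma bipartite_diam : a < b ->
  le_ext (diam (gen_graph_star G a b)) 4 /\
  (End_gt2 G \/ a <> 1%N -> le_ext (diam (gen_graph_star G a b)) 3).
Proof.
move=> lt_ab.
have dist_aa (v w : star) : size (entry_seq v) = a -> size (entry_seq w) = a -> dist_le 2 v w.
  move=> sz_v sz_w; apply: (star_dist2 ab) => //.
  have [b1 | nb1] := eqVneq b 1%N; last by apply/Or33/eqP.
  apply: Or31; have a0: a = 0 by move: lt_ab; rewrite b1; case: (a).
  by rewrite (size0nil (etrans sz_v a0)) (size0nil (etrans sz_w a0)).
have dist_ab (v w : star) : size (entry_seq v) = a -> size (entry_seq w) = b -> dist_le 3 v w.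
  move=> sz_v sz_w; have [u wu sz_u] := star_nb_size ba sz_w.
  by apply/dist_symm/(dist_cons wu)/dist_aa.
split=> [|cond]; apply/diam_leP=> v w.
  have [sz_v | sz_v] := star_size v; have [sz_w | sz_w] := star_size w.
  - exact: (@dist_leW 2 4) (dist_aa _ _ sz_v sz_w).
  - exact: (@dist_leW 3 4) (dist_ab _ _ sz_v sz_w).
  - exact: (@dist_leW 3 4) (dist_symm (dist_ab _ _ sz_w sz_v)).
  have [u vu sz_u] := star_nb_size ba sz_v.
  exact: (dist_cons vu (dist_ab _ _ sz_u sz_w)).
have [sz_v | sz_v] := star_size v; have [sz_w | sz_w] := star_size w.
- exact: (@dist_leW 2 3) (dist_aa _ _ sz_v sz_w).
- exact: dist_ab.
- exact/dist_symm/dist_ab.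
apply: (@dist_leW 2 3) => //; apply: (star_dist2 ba) => //.
by case: cond => [? | ?]; [apply: Or32 | apply: Or33].
Qed.

End Graph.

Lemma diagonal_diam (gT : finGroupType) (G : {group gT}) a : solvable G ->
  End_gt2 G \/ a <> 1%N -> le_ext (diam (gen_graph_star G a a)) 2.
Proof.
move=> solG cond; apply/diam_leP=> v w.
have sz (u : vertex (gen_graph_star G a a)) : size (entry_seq u) = a.
  by case: (star_size u).
apply: (star_dist2 (leqnn a) solG (or_introl (conj erefl erefl))) => //.
by case: cond => [? | ?]; [apply: Or32 | apply: Or33].
Qed.

Lemma diagonal1_diam (gT : finGroupType) (G : {group gT}) : solvable G ->
  le_ext (diam (gen_graph_star G 1 1)) 3.
Proof.
move=> solG; apply/diam_leP=> v w.
have seq1 (u : vertex (gen_graph_star G 1 1)) : exists2 x, x \in G & entry_seq u = [:: x].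
  have [sz Gu] := entry_seqP u; have: size (entry_seq u) = 1%N by case: (star_size u).
  by case: (entry_seq u) Gu => // x [] //= /andP[Gx _] _; exists x.
have gen1 x y : seq_adj G 1 1 [:: x] [:: y] = (<<[set x; y]>> == G).
  by rewrite /seq_adj /=; congr (<<_>> == _); apply/setP=> z; rewrite !inE.
have nb (u : vertex (gen_graph_star G 1 1)) x : entry_seq u = [:: x] ->
    exists2 y, y \in G & <<[set y; x]>> = G.
  move=> ux; have [u' uu'] := star_nb (leqnn 1%N) u; have [y Gy u'y] := seq1 u'.
  by exists y => //; apply/eqP; rewrite setUC -gen1 -ux -u'y.
have [x Gx vx] := seq1 v; have [x' Gx' wx'] := seq1 w.
have [y1 [y2 [[Gy1 Gy2]]]] := walk_exists solG Gx Gx' (nb _ _ vx) (nb _ _ wx').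
rewrite !mul1g => g1 g2 g3.
have all1 z : z \in G -> all [in G] [:: z] by move=> Gz; rewrite /= Gz.
have [|u1 u1y] := star_of_seq (leqnn 1%N) (all1 _ Gy1) (all1 _ Gx); first by rewrite gen1 g1.
have [|u2 u2y] := star_of_seq (leqnn 1%N) (all1 _ Gy2) (all1 _ Gx'); first by rewrite gen1 g3.
apply: (dist_cons (v := u1)); first by rewrite adjE vx u1y gen1 setUC g1.
apply: (dist_cons (v := u2)); first by rewrite adjE u1y u2y gen1 g2.
by apply: dist_adj; rewrite adjE u2y wx' gen1 g3.
Qed.

Local Close Scope group_scope.

Theorem corollary3p11 (gT : finGroupType) (G : {group gT}) (a b : nat) :
  solvable G -> a <= b -> gen_rank G <= a + b ->
  [/\ le_ext (diam (gen_graph_star G a b)) 4,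
      a = b ->
        (End_gt2 G \/ a <> 1 -> le_ext (diam (gen_graph_star G a a)) 2) /\
        (~ (End_gt2 G \/ a <> 1) -> le_ext (diam (gen_graph_star G a a)) 3)
    & a < b ->
        End_gt2 G \/ a <> 1 -> le_ext (diam (gen_graph_star G a b)) 3].
Proof.
move=> solG le_ab _.
have leW d m n : m <= n -> le_ext d m -> le_ext d n.
  by case: d => //= d le_mn /leq_trans->.
split; last 2 first.
- move=> _; split; first exact: diagonal_diam.
  have [-> _ | neq1 []] := eqVneq a 1%N; first exact: diagonal1_diam.
  by right; apply/eqP.
- by move=> lt_ab; case: (bipartite_diam le_ab solG lt_ab).
have [lt_ab | le_ba] := ltnP a b; first by case: (bipartite_diam le_ab solG lt_ab).
have <-: a = b by apply/eqP; rewrite eqn_leq le_ab.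
have [-> | neq1] := eqVneq a 1%N; first exact: (leW _ 3 4) (diagonal1_diam solG).
by apply: (leW _ 2 4) => //; apply: diagonal_diam => //; right; apply/eqP.
Qed.
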